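(* Let $T>0$, let $H$ and $m_0$ satisfy the standing assumptions of the context, and let $(u,m)\in C^2(\overline{Q_T})\times C^1(\overline{Q_T})$ be a classical solution to $$-u_t+H(u_x,m)=0\ \text{ in }Q_T,\qquad m_t-(mH_p(u_x,m))_x=0\ \text{ in }Q_T,\qquad m(\cdot,0)=m_0\ \text{ in }\mathbb T,$$ and let $h\in W^{2,\infty}(\mathbb R)$. Then $$\frac{d^2}{dt^2}\int_{\mathbb T}h(m(x,t))\,dx=\int_{\mathbb T}h''(m)\Big(m_t-m_x\big(H_p+\tfrac m2H_{pm}\big)\Big)^2dx-\int_{\mathbb T}h''(m)(m_x)^2\Big(\tfrac{m^2}4H_{pm}^2+mH_{pp}H_m\Big)dx.$$ Moreover, there exists a constant $C=C(C_0)>0$ such that, if $h''>0$, $$\frac{d^2}{dt^2}\int_{\mathbb T}h(m(x,t))\,dx\ge\frac1C\int_{\mathbb T}h''(m)\big(-mH_mH_{pp}m_x^2+m^2H_{pp}^2u_{xx}^2\big)dx.$$ Here the derivatives of $H$ are evaluated at $(u_x,m)$.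
   Context: $\mathbb T$ is the one-dimensional torus (of length 1), $Q_T=\mathbb T\times(0,T)$, $\overline{Q_T}=\mathbb T\times[0,T]$. $H=H(p,m):\mathbb R\times(0,\infty)\to\mathbb R$; subscripts denote partial derivatives. A classical solution has $m>0$ on $\overline{Q_T}$ and satisfies the equations pointwise. $C_0>0$, $\gamma>1$, $0<\alpha<1$ are constants and $\overline C:(0,\infty)\to(0,\infty)$ is a continuous function. Standing assumptions: (M) $m_0\in C^{2,\alpha}(\mathbb T)$, $m_0>0$, $\int_{\mathbb T}m_0=1$. (H) $H,H_p,H_{pp}\in C^4(\mathbb R\times(0,\infty))$, $H_m<0$, and for all $(p,m)\in\mathbb R\times(0,\infty)$: $\frac1{C_0}(1+|p|)^{\gamma-2}\le H_{pp}\le\overline C(m)(1+|p|)^{\gamma-2}$; $pH_p\ge(1+\frac1{C_0})H-\overline C(m)$; $|H_{ppp}|\le\overline C(m)(1+|p|)^{\gamma-3}$; $|H_m|\le\overline C(m)(1+|p|)^\gamma$; $m|H_{mm}|\le-\overline C(m)H_m$; $|p||H_{mp}|\le-\overline C(m)H_m$; $m|p||H_{mmp}|\le-\overline C(m)H_m$; $|H_{mpp}|\le\overline C(m)(1+|p|)^{\gamma-2}$. (E) $-4mH_mH_{pp}\ge(1+\frac1{C_0})m^2H_{mp}^2$ for all $(p,m)\in\mathbb R\times(0,\infty)$. *)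

(* Defs.v *)
From HB Require Import structures.
From mathcomp Require Export all_boot all_order all_algebra.
From mathcomp Require Export all_classical all_reals all_analysis.
Export Order.TTheory GRing.Theory Num.Theory.
Export numFieldNormedType.Exports.

Set Implicit Arguments.
Unset Strict Implicit.
Unset Printing Implicit Defensive.

Local Open Scope ring_scope.
Local Open Scope classical_set_scope.

Section PartialDerivatives.
Context {R : realType}.
Implicit Types (f : R -> R -> R) (U : set (R * R)).

Definition d1 f : R -> R -> R := fun x y => (fun s => f s y)^`() x.
Definition d2 f : R -> R -> R := fun x y => (f x)^`() y.

Definition partials_exist U f :=
  forall x y, U (x, y) -> derivable (fun s => f s y) x 1 /\ derivable (f x) y 1.

(* f \in C^k(U), for U open *)
Fixpoint Ck (k : nat) U f : Prop :=
  {within U, continuous (fun z => f z.1 z.2)} /\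
  if k is k'.+1 then
    [/\ partials_exist U f, Ck k' U (d1 f) & Ck k' U (d2 f)]
  else True.

(* f and all its partial derivatives of order at most k exist in U and extend
   continuously to the closure of U (U open) *)
Fixpoint Ck_extends (k : nat) U f : Prop :=
  (exists2 g : R * R -> R, {within closure U, continuous g} &
     forall z, U z -> g z = f z.1 z.2) /\
  if k is k'.+1 then
    [/\ partials_exist U f, Ck_extends k' U (d1 f) & Ck_extends k' U (d2 f)]
  else True.

(* f \in C^k(closure U): the values of f on the boundary of U are those of its
   continuous extension; [d1 f] and [d2 f] are meaningful only in U. *)
Definition Ck_closure (k : nat) U f : Prop :=
  {within closure U, continuous (fun z => f z.1 z.2)} /\ Ck_extends k U f.

End PartialDerivatives.

(* Functions on the torus of length 1 are 1-periodic functions on R, and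
   integrals over the torus are integrals over [0, 1]. *)
Notation "\int[T]_ x f" :=
  (\int[@lebesgue_measure _]_(x in `[0%R, 1%R]) f)%R
  (at level 36, x name, f at level 36, only parsing) : ring_scope.

Section Assumptions.
Context {R : realType}.

(* the lift R x (0, T) of Q_T to the universal cover *)
Definition strip (T : R) : set (R * R) := [set z | 0 < z.2 < T].

Definition halfplane : set (R * R) := [set z | 0 < z.2].

Record initial_density (alpha : R) (m0 : R -> R) : Prop := {
  m0_periodic : periodic m0 1;
  m0_derivable : forall x, derivable m0 x 1;
  m0_derivable2 : forall x, derivable m0^`() x 1;
  m0_holder : exists K, forall x y,
    `|(m0^`()^`() x)%classic - (m0^`()^`() y)%classic| <= K * `|x - y| `^ alpha;
  m0_gt0 : forall x, 0 < m0 x;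
  m0_mass : \int[T]_ x (m0 x) = 1 }.

(* H = H(p, m), so d1 = d/dp and d2 = d/dm *)
Record hamiltonian (C0 gamma : R) (Cbar : R -> R) (H : R -> R -> R) : Prop := {
  H_C4 : Ck 4 halfplane H;
  Hp_C4 : Ck 4 halfplane (d1 H);
  Hpp_C4 : Ck 4 halfplane (d1 (d1 H));
  Hm_lt0 : forall p m, 0 < m -> d2 H p m < 0;
  Hpp_ge : forall p m, 0 < m ->
    C0^-1 * (1 + `|p|) `^ (gamma - 2) <= d1 (d1 H) p m;
  Hpp_le : forall p m, 0 < m ->
    d1 (d1 H) p m <= Cbar m * (1 + `|p|) `^ (gamma - 2);
  pHp_ge : forall p m, 0 < m ->
    (1 + C0^-1) * H p m - Cbar m <= p * d1 H p m;
  Hppp_le : forall p m, 0 < m ->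
    `|d1 (d1 (d1 H)) p m| <= Cbar m * (1 + `|p|) `^ (gamma - 3);
  Hm_le : forall p m, 0 < m ->
    `|d2 H p m| <= Cbar m * (1 + `|p|) `^ gamma;
  Hmm_le : forall p m, 0 < m ->
    m * `|d2 (d2 H) p m| <= - Cbar m * d2 H p m;
  Hmp_le : forall p m, 0 < m ->
    `|p| * `|d1 (d2 H) p m| <= - Cbar m * d2 H p m;
  Hmmp_le : forall p m, 0 < m ->
    m * `|p| * `|d1 (d2 (d2 H)) p m| <= - Cbar m * d2 H p m;
  Hmpp_le : forall p m, 0 < m ->
    `|d1 (d1 (d2 H)) p m| <= Cbar m * (1 + `|p|) `^ (gamma - 2) }.

Definition ellipticity (C0 : R) (H : R -> R -> R) : Prop :=
  forall p m, 0 < m ->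
    (1 + C0^-1) * m ^+ 2 * d1 (d2 H) p m ^+ 2
      <= - 4 * m * d2 H p m * d1 (d1 H) p m.

Record classical_solution (T : R) (H : R -> R -> R) (m0 : R -> R)
    (u m : R -> R -> R) : Prop := {
  u_periodic : forall t, 0 <= t <= T -> periodic (fun x => u x t) 1;
  m_periodic : forall t, 0 <= t <= T -> periodic (fun x => m x t) 1;
  u_C2 : Ck_closure 2 (strip T) u;
  m_C1 : Ck_closure 1 (strip T) m;
  m_gt0 : forall x t, 0 <= t <= T -> 0 < m x t;
  hamilton_jacobi : forall x t, 0 < t < T ->
    - d2 u x t + H (d1 u x t) (m x t) = 0;
  continuity_equation : forall x t, 0 < t < T ->
    d2 m x t - d1 (fun y s => m y s * d1 H (d1 u y s) (m y s)) x t = 0;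
  initial_condition : forall x, m x 0 = m0 x }.

End Assumptions.

Section Sobolev.
Context {R : realType}.
Local Notation mu := (@lebesgue_measure R).

(* C^1 functions with compact support *)
Definition test_function (phi : R -> R) : Prop :=
  [/\ forall x, derivable phi x 1,
      continuous phi^`() &
      compact (closure [set x | phi x != 0])].

(* g is the weak derivative of f on R. As in Brezis, the test functions are
   C^1_c; by mollification this agrees with testing against C^oo_c. *)
Definition weak_derivative (f g : R -> R) : Prop :=
  forall phi, test_function phi ->
    (\int[mu]_x (f x * (phi^`() x)%classic) = - \int[mu]_x (g x * phi x))%R.

(* h is the continuous representative of an element of W^{2,oo}(R) and h2 is
   any (Borel) representative of its second weak derivative. *)
Definition W2oo (h h2 : R -> R) : Prop :=
  [/\ continuous h, h \in Lfun mu +oo%E, h2 \in Lfun mu +oo%E &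
      exists2 h1 : R -> R, h1 \in Lfun mu +oo%E &
        weak_derivative h h1 /\ weak_derivative h1 h2].

End Sobolev.

(* Main.v *)
Require Import Defs.
From mathcomp Require Import measurable_realfun ess_sup_inf ring lra.
Set Implicit Arguments.
Unset Strict Implicit.
Unset Printing Implicit Defensive.
Local Open Scope ring_scope.
Local Open Scope classical_set_scope.

(** Write [w = H_p(u_x, m)], so that the continuity equation is [m_t = (m w)_x],
    and [P(s) = s h'(s) - h(s)], so that [P'(s) = s h''(s)].  Integrating by parts,
      [F'(t) = \int h'(m) m_t = \int P(m) w_x],
      [F''(t) = \int P'(m) (m_t w_x - m_x w_t)],
    the second line because the mixed derivative [w_xt] cancels.  The
    [x]-derivative of the Hamilton-Jacobi equation expresses [w_t] through
    [u_xx], [m_x] and [m_t]; substituting, the integrand becomes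
    [h''(m)] times the expression in the statement ([rate_identity]), and
    ellipticity bounds that quadratic form from below ([rate_lower_bound]).

    The work lies in the regularity: [m] is only C^1, [w_xt] need not exist and
    [h''] is an element of L^oo.

    - A W^{2,oo} function has a Lipschitz derivative whose almost everywhere
      derivative is the weak second derivative ([W2oo_representative]).  This
      rests on [weak_derivative_increment], obtained with explicit C^1 test
      functions at Lebesgue points.

    - [h''(m)] makes no sense where [m] takes values in the null set on which
      [h''] is not the derivative of [h'].  A differentiable function visits a
      null set almost only at stationary points ([negligible_critical_preimage]);
      with Fubini, for almost every [t] one has [m_x = m_t = 0] at almost every
      such [x] ([ae_strip_regular]).  At these points every integrand involved
      vanishes, and Lipschitz continuity replaces the chain rule
      ([is_derive_lipschitz_comp]).

    - The increment of [F'] between two times [t] and [s] is, exactly,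
        [\int (P(m_s) - P(m_t)) (w_s)_x - \int P(m_t)_x (w_s - w_t)],
      the subscripts [s] and [t] denoting values at these times
      ([energy_rate_increment]); the integration by parts uses the fundamental
      theorem of calculus for Lipschitz functions ([FTC_lipschitz]).  It
      contains first derivatives only, which gives the Lipschitz bound on [F'],
      and dominated convergence as [s] tends to a good time [t] gives [F'']
      ([is_derive_energy_rate]). *)

(** * One-variable calculus *)

Section Calculus.
Context {R : realType}.
Implicit Types (f g : R -> R).

Let remainder_quotient f (s t d : R) : s != t ->
  `|d - (s - t)^-1 * (f s - f t)| = `|f s - f t - d * (s - t)| / `|s - t|.
Proof.
by move=> st; rewrite -normf_div distrC mulrBl mulfK ?subr_eq0// mulrC.
Qed.

Lemma is_derive1P f (t d : R) :
  is_derive t 1 f d <-> forall e : R, 0 < e -> exists2 r : R, 0 < r &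
    forall s, `|s - t| < r -> `|f s - f t - d * (s - t)| <= e * `|s - t|.
Proof.
split=> [fd e e0|H].
  have /cvg_ex[l fl] : derivable f t 1 by case: fd.
  have ld : l = d.
    by case: fd => _ <-; apply/esym/cvg_lim.
  move: fl; rewrite {}ld => /cvgrPdist_lt/(_ _ e0) -[/= r r0 Hr].
  exists r => // s sr.
  have [->|st] := eqVneq s t; first by rewrite !subrr mulr0 subrr normr0 mulr0.
  have := Hr (s - t); rewrite /ball_ /= sub0r normrN => /(_ sr).
  rewrite subr_eq0 st => /(_ isT).
  rewrite scaler1 subrK /GRing.scale/= remainder_quotient//.
  by rewrite ltr_pdivrMr ?normr_gt0 ?subr_eq0// => /ltW.
have fl : h^-1 *: (f (h *: 1 + t) - f t) @[h --> 0^'] --> d.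
  apply/cvgrPdist_le => /= e e0; have [r r0 Hr] := H _ e0.
  exists r => //= h; rewrite /ball_/= sub0r normrN => hr h0.
  rewrite scaler1 /GRing.scale/=.
  have st : h + t != t by rewrite -subr_eq0 addrK.
  have := remainder_quotient f d st; rewrite addrK => ->.
  rewrite ler_pdivrMr ?normr_gt0//.
  by have := Hr (h + t); rewrite addrK; exact.
apply: DeriveDef; first by apply/cvg_ex; exists d.
exact/cvg_lim.
Qed.

Lemma is_derive_quotientP f (t d : R) :
  is_derive t 1 f d <-> (s - t)^-1 * (f s - f t) @[s --> t^'] --> d.
Proof.
split=> [/is_derive1P H|H].
  apply/cvgrPdist_le => e e0; have [r r0 Hr] := H e e0.
  exists r => // s /=; rewrite distrC => sr st.
  rewrite remainder_quotient// ler_pdivrMr ?normr_gt0 ?subr_eq0//.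
  exact: Hr.
apply/is_derive1P => e e0; move/cvgrPdist_le : H => /(_ _ e0)[r /= r0 Hr].
exists r => // s sr.
have [->|st] := eqVneq s t; first by rewrite !subrr mulr0 subrr normr0 mulr0.
rewrite distrC in sr; have := Hr s sr st; rewrite remainder_quotient//.
by rewrite ler_pdivrMr ?normr_gt0 ?subr_eq0.
Qed.

Lemma derivable_is_derive1 f (t : R) :
  derivable f t 1 -> is_derive t 1 f (f^`()%classic t).
Proof. by move=> ft; apply: DeriveDef => //; rewrite derive1E. Qed.

Lemma is_derive_derive1 f (t d : R) : is_derive t 1 f d -> f^`()%classic t = d.
Proof. by move=> fd; rewrite derive1E derive_val. Qed.

Lemma is_derive1_continuous f (t d : R) :
  is_derive t 1 f d -> {for t, continuous f}.
Proof.
by case=> ft _; apply: differentiable_continuous; exact/derivable1_diffP.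
Qed.

(** The mean value theorem without an assumption on which endpoint is the
    smaller one: a symmetric interval around [x] hosts both cases. *)
Lemma MVT_center f (df : R -> R) (x y : R) :
  (forall z, `|z - x| <= `|y - x| -> is_derive z 1 f (df z)) ->
  exists2 z, `|z - x| <= `|y - x| & f y - f x = df z * (y - x).
Proof.
move=> fd.
have itv (a b : R) : a <= b -> (forall z : R, a <= z <= b -> is_derive z 1 f (df z)) ->
    exists2 z, a <= z <= b & f b - f a = df z * (b - a).
  move=> ab abf; have [||z] := @MVT_segment R f df a b ab.
  - by move=> z; rewrite in_itv/= => /andP[az zb]; apply: abf; rewrite !ltW.
  - apply: derivable_within_continuous => z; rewrite in_itv/= => zab.
    by have [] := abf _ zab.
  - by rewrite in_itv/= => zab zE; exists z.
have [xy|/ltW yx] := leP x y.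
  have [|z zxy zE] := itv x y xy.
    move=> z /andP[xz zy]; apply: fd.
    by rewrite !ger0_norm ?subr_ge0// lerB.
  exists z => //; move/andP: zxy => [xz zy].
  by rewrite !ger0_norm ?subr_ge0// lerB.
have [|z zxy zE] := itv y x yx.
  move=> z /andP[xz zy]; apply: fd.
  by rewrite !ler0_norm ?subr_le0// !opprB lerB.
exists z; last by rewrite -opprB zE -mulrN opprB.
move/andP: zxy => [xz zy].
by rewrite !ler0_norm ?subr_le0// !opprB lerB.
Qed.

Lemma derive_bounded_lipschitz f (df : R -> R) (M x y : R) :
  (forall z, `|z - x| <= `|y - x| -> is_derive z 1 f (df z) /\ `|df z| <= M) ->
  `|f y - f x| <= M * `|y - x|.
Proof.
move=> fd; have [z zx ->] := MVT_center (fun z zx => (fd z zx).1).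
by rewrite normrM ler_wpM2r// (fd _ zx).2.
Qed.

(** Chain rule with an outer function that need not be differentiable where
    the inner derivative vanishes: there the Lipschitz bound alone makes the
    composite increments negligible.  This is what makes the second derivative
    of a W^{2,oo} function usable along a C^1 density. *)
Lemma is_derive_lipschitz_comp (G phi : R -> R) (t d g L : R) :
  (\forall s \near t, `|G (phi s) - G (phi t)| <= L * `|phi s - phi t|) ->
  is_derive t 1 phi d -> (d != 0 -> is_derive (phi t) 1 G g) ->
  is_derive t 1 (fun s => G (phi s)) (g * d).
Proof.
move=> GL phid Gg; have [d0|d0] := eqVneq d 0; last first.
  exact: (is_derive1_comp (Gg d0) phid).
rewrite d0 mulr0; apply/is_derive1P => e e0.
have L0 : 0 < `|L| + 1 by rewrite ltr_wpDl.
have eL0 : 0 < e / (`|L| + 1) by rewrite divr_gt0.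
have [r r0 Hr] := (is_derive1P _ _ _).1 phid _ eL0.
have [r' r'0 GLr] : exists2 r', 0 < r' & forall s, `|s - t| < r' ->
    `|G (phi s) - G (phi t)| <= L * `|phi s - phi t|.
  case: GL => r' /= r'0 H; exists r' => // s; rewrite distrC; exact: H.
exists (Num.min r r'); first by rewrite lt_min r0 r'0.
move=> s; rewrite lt_min => /andP[sr sr'].
rewrite mul0r subr0 (le_trans (GLr _ sr'))//.
have := Hr _ sr; rewrite d0 mul0r subr0 => H.
apply: (@le_trans _ _ ((`|L| + 1) * `|phi s - phi t|)).
  by rewrite ler_wpM2r// (le_trans (ler_norm _))// lerDl.
by rewrite -ler_pdivlMl// mulrA (mulrC _^-1).
Qed.

Lemma lipschitz_continuous f (L : R) :
  (forall x y, `|f x - f y| <= L * `|x - y|) -> continuous f.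
Proof.
move=> fL x; apply/cvgrPdist_le => e e0.
have L0 : 0 < `|L| + 1 by rewrite ltr_wpDl.
exists (e / (`|L| + 1)) => /=; first by rewrite divr_gt0.
move=> y /=; rewrite ltr_pdivlMr// => xy.
rewrite (le_trans (fL _ _))// (le_trans _ (ltW xy))// mulrC ler_wpM2l//.
by rewrite (le_trans (ler_norm _))// lerDl.
Qed.

Lemma lipschitzM f g (A B La Lb : R) :
  (forall x, `|f x| <= A) -> (forall x, `|g x| <= B) ->
  (forall x y, `|f x - f y| <= La * `|x - y|) ->
  (forall x y, `|g x - g y| <= Lb * `|x - y|) ->
  forall x y, `|f x * g x - f y * g y| <= (A * Lb + La * B) * `|x - y|.
Proof.
move=> fA gB fL gL x y.
have -> : f x * g x - f y * g y = f x * (g x - g y) + (f x - f y) * g y by ring.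
rewrite (le_trans (ler_normD _ _))// !normrM mulrDl lerD//.
  by rewrite -mulrA ler_pM.
by rewrite mulrAC ler_pM.
Qed.

Lemma lipschitz_derive_le f (K x d : R) :
  (forall y, `|f y - f x| <= K * `|y - x|) -> is_derive x 1 f d -> `|d| <= K.
Proof.
move=> fL /is_derive1P fd; apply/ler_addgt0Pr => e e0.
have [r r0 Hr] := fd _ e0.
have r20 : 0 < r / 2 by rewrite divr_gt0.
have := Hr (x + r / 2); rewrite addrAC subrr add0r (gtr0_norm r20).
move=> /(_ ltac:(lra)) H.
have := fL (x + r / 2); rewrite addrAC subrr add0r (gtr0_norm r20) => H2.
rewrite -(ler_pM2r r20) -{1}(gtr0_norm r20) -normrM.
have -> : d * (r / 2) = (f (x + r / 2) - f x)
  - (f (x + r / 2) - f x - d * (r / 2)) by ring.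
by rewrite (le_trans (ler_normB _ _))// mulrDl lerD.
Qed.

Lemma is_derive1M f g (x df dg : R) : is_derive x 1 f df -> is_derive x 1 g dg ->
  is_derive x 1 (fun y => f y * g y) (df * g x + f x * dg).
Proof.
move=> fd gd; have := is_deriveM fd gd.
by rewrite /GRing.scale/= addrC (mulrC _ df).
Qed.

Lemma continuous_mulf f g : continuous f -> continuous g ->
  continuous (fun x => f x * g x).
Proof. by move=> cf cg x; apply: cvgM; [exact: cf|exact: cg]. Qed.

Lemma continuous_addf f g : continuous f -> continuous g ->
  continuous (fun x => f x + g x).
Proof. by move=> cf cg x; apply: cvgD; [exact: cf|exact: cg]. Qed.

Lemma continuous_oppf f : continuous f -> continuous (fun x => - f x).
Proof. by move=> cf x; apply: cvgN; exact: cf. Qed.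

Lemma continuous_sqrf f : continuous f -> continuous (fun x => f x ^+ 2).
Proof. by move=> cf; under eq_fun do rewrite expr2; exact: continuous_mulf. Qed.

End Calculus.

(** * Two-variable calculus *)

Section Partial.
Context {R : realType}.
Implicit Types (f K : R -> R -> R) (U : set (R * R)).

Lemma continuous_at2P f (p q : R) :
  {for (p, q), continuous (fun z : R * R => f z.1 z.2)} ->
  forall e : R, 0 < e -> exists2 r : R, 0 < r & forall x y,
    `|x - p| < r -> `|y - q| < r -> `|f x y - f p q| <= e.
Proof.
move=> cf e e0; have /cvgrPdist_le/(_ _ e0) := cf.
move=> /nbhs_ballP[/= r r0 H]; exists r => // x y xp yq.
rewrite distrC; apply: (H (x, y)).
by split; rewrite /ball/= distrC.
Qed.

Lemma open_ball2 U (p q : R) : open U -> U (p, q) ->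
  exists2 r : R, 0 < r & forall x y, `|x - p| < r -> `|y - q| < r -> U (x, y).
Proof.
move=> oU Upq; have /nbhs_ballP[/= r r0 H] : nbhs (p, q) U.
  exact: open_nbhs_nbhs.
exists r => // x y xp yq; apply: H.
by split; rewrite /ball/= distrC.
Qed.

Lemma Ck_for_continuous k U f (p q : R) : open U -> Ck k U f -> U (p, q) ->
  {for (p, q), continuous (fun z : R * R => f z.1 z.2)}.
Proof.
move=> oU fk Upq; have : {within U, continuous (fun z : R * R => f z.1 z.2)}.
  by case: k fk => [|k] [].
by rewrite (continuous_open_subspace _ oU); apply; exact/mem_set.
Qed.

Lemma Ck_pred k U f : Ck k.+1 U f -> Ck k U f.
Proof.
elim: k f => [f [cf _]|k IH f]; first by split.
move=> [cf [pf f1 f2]]; split; first exact: cf.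
by split; [exact: pf|exact: (IH _ f1)|exact: (IH _ f2)].
Qed.

Lemma Ck_d1 k U f : Ck k.+1 U f -> Ck k U (d1 f).
Proof. by case=> _ []. Qed.

Lemma Ck_d2 k U f : Ck k.+1 U f -> Ck k U (d2 f).
Proof. by case=> _ []. Qed.

Lemma Ck_is_derive1 k U f x y : Ck k.+1 U f -> U (x, y) ->
  is_derive x 1 (f ^~ y) (d1 f x y).
Proof. by case=> _ [pf _ _] Uxy; apply/derivable_is_derive1/(pf x y Uxy).1. Qed.

Lemma Ck_is_derive2 k U f x y : Ck k.+1 U f -> U (x, y) ->
  is_derive y 1 (f x) (d2 f x y).
Proof. by case=> _ [pf _ _] Uxy; apply/derivable_is_derive1/(pf x y Uxy).2. Qed.

(** Continuity of one partial derivative and existence of the other at the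
    point suffice: the mean value theorem handles the first variable, the
    definition of the derivative the second. *)
Lemma partial_differential U K (p q : R) : open U -> Ck 1 U K -> U (p, q) ->
  forall e : R, 0 < e -> exists2 r : R, 0 < r & forall x y, `|x - p| < r -> `|y - q| < r ->
    `|K x y - K p q - d1 K p q * (x - p) - d2 K p q * (y - q)|
      <= e * (`|x - p| + `|y - q|).
Proof.
move=> oU KU Upq e e0.
have [r0 r00 Hr0] := open_ball2 oU Upq.
have [r1 r10 Hr1] := continuous_at2P (Ck_for_continuous oU (Ck_d1 KU) Upq) e0.
have [r2 r20 Hr2] := (is_derive1P _ _ _).1 (Ck_is_derive2 KU Upq) _ e0.
exists (Num.min r0 (Num.min r1 r2)); first by rewrite !lt_min r00 r10 r20.
move=> x y; rewrite !lt_min => /and3P[x0 x1 x2] /and3P[y0 y1 y2].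
have [z zp zE] : exists2 z, `|z - p| <= `|x - p| &
    K x y - K p y = d1 K z y * (x - p).
  apply: (@MVT_center _ (K ^~ y)) => z zx; apply: (Ck_is_derive1 KU).
  by apply: Hr0 => //; exact: le_lt_trans x0.
have -> : K x y - K p q - d1 K p q * (x - p) - d2 K p q * (y - q) =
  (d1 K z y - d1 K p q) * (x - p) + (K p y - K p q - d2 K p q * (y - q)).
  rewrite mulrBl -zE; move: (d1 K p q * _) (d2 K p q * _) => A B.
  by move: (K x y) (K p q) (K p y) => X Y Z; ring.
rewrite (le_trans (ler_normD _ _))// [leRHS]mulrDr lerD//; last exact: Hr2.
rewrite normrM ler_wpM2r//; apply: Hr1 => //; exact: le_lt_trans x1.
Qed.

Lemma is_derive_comp2 U K (a b : R -> R) (t a' b' : R) : open U -> Ck 1 U K ->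
  U (a t, b t) -> is_derive t 1 a a' -> is_derive t 1 b b' ->
  is_derive t 1 (fun s => K (a s) (b s))
    (d1 K (a t) (b t) * a' + d2 K (a t) (b t) * b').
Proof.
move=> oU KU Uab ad bd; apply/is_derive1P => e e0.
have dK := partial_differential oU KU Uab.
move: (d1 K (a t) (b t)) (d2 K (a t) (b t)) dK => K1 K2 dK.
pose S := `|a'| + `|b'| + 2 + `|K1| + `|K2|.
have S0 : 0 < S.
  by rewrite /S; have := normr_ge0 a'; have := normr_ge0 b';
    have := normr_ge0 K1; have := normr_ge0 K2; lra.
pose e' := Num.min 1 (e / S / 2).
have e'0 : 0 < e' by rewrite lt_min ltr01/= !divr_gt0.
have e'1 : e' <= 1 by rewrite ge_min lexx.
have e'S : e' * S <= e / 2.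
  rewrite -ler_pdivlMr// (@le_trans _ _ (e / S / 2))//; last by rewrite mulrAC.
  by rewrite ge_min lexx orbT.
have [r r0 Hr] := dK _ e'0.
have [ra ra0 Ha] := (is_derive1P _ _ _).1 ad _ e'0.
have [rb rb0 Hb] := (is_derive1P _ _ _).1 bd _ e'0.
pose r' := Num.min (Num.min ra rb) (r / S).
exists r'; first by rewrite !lt_min ra0 rb0/= divr_gt0.
move=> s; rewrite !lt_min => /andP[/andP[/Ha sa /Hb sb]].
rewrite ltr_pdivlMr// => sr.
have n0 := normr_ge0 (s - t).
have n1 := normr_ge0 K1; have n2 := normr_ge0 K2.
have n3 := normr_ge0 a'; have n4 := normr_ge0 b'.
have e'n : e' * `|s - t| <= `|s - t| by rewrite ler_piMl.
have da : `|a s - a t| <= (`|a'| + 1) * `|s - t|.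
  have := ler_normD (a s - a t - a' * (s - t)) (a' * (s - t)).
  by rewrite subrK normrM; move: sa e'n; lra.
have db : `|b s - b t| <= (`|b'| + 1) * `|s - t|.
  have := ler_normD (b s - b t - b' * (s - t)) (b' * (s - t)).
  by rewrite subrK normrM; move: sb e'n; lra.
have := Hr (a s) (b s).
have -> : `|a s - a t| < r.
  rewrite (le_lt_trans da)// (le_lt_trans _ sr)// mulrC ler_wpM2l// /S; lra.
have -> : `|b s - b t| < r.
  rewrite (le_lt_trans db)// (le_lt_trans _ sr)// mulrC ler_wpM2l// /S; lra.
move=> /(_ isT isT) HK.
have -> : K (a s) (b s) - K (a t) (b t) - (K1 * a' + K2 * b') * (s - t) =
  (K (a s) (b s) - K (a t) (b t) - K1 * (a s - a t) - K2 * (b s - b t))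
  + K1 * (a s - a t - a' * (s - t)) + K2 * (b s - b t - b' * (s - t)) by ring.
apply: (@le_trans _ _ (e' * S * `|s - t|)); last first.
  by rewrite ler_wpM2r// (le_trans e'S)//; move: e0; lra.
apply: (le_trans (ler_normD _ _)).
apply: (@le_trans _ _ (e' * (`|a s - a t| + `|b s - b t|)
  + `|K1| * (e' * `|s - t|) + `|K2| * (e' * `|s - t|))).
  apply: lerD; last by rewrite normrM ler_wpM2l.
  apply: (le_trans (ler_normD _ _)); apply: lerD => //.
  by rewrite normrM ler_wpM2l.
apply: (@le_trans _ _ (e' * ((`|a'| + 1) * `|s - t| + (`|b'| + 1) * `|s - t|)
  + `|K1| * (e' * `|s - t|) + `|K2| * (e' * `|s - t|))).
  apply: lerD => //; apply: lerD => //.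
  by rewrite (ler_wpM2l (ltW e'0))// lerD.
by rewrite /S le_eqVlt; apply/orP; left; apply/eqP; ring.
Qed.

(** Both mixed derivatives are limits of the same second difference [D] over a
    square of side [r], each obtained by applying the mean value theorem to the
    two variables in one of the two orders. *)
Lemma schwarz U f (x y : R) : open U -> Ck 2 U f -> U (x, y) ->
  d1 (d2 f) x y = d2 (d1 f) x y.
Proof.
move=> oU fU Uxy; apply/eqP; rewrite -subr_eq0 -normr_le0.
apply/ler_addgt0Pr => e e0; rewrite add0r.
have e20 : 0 < e / 2 by rewrite divr_gt0.
have f1 := Ck_d1 fU; have f2 := Ck_d2 fU; have f0 := Ck_pred fU.
have [r0 r00 Hr0] := open_ball2 oU Uxy.
have [r1 r10 Hr1] := continuous_at2P (Ck_for_continuous oU (Ck_d2 f1) Uxy) e20.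
have [r2 r20 Hr2] := continuous_at2P (Ck_for_continuous oU (Ck_d1 f2) Uxy) e20.
pose r := Num.min r0 (Num.min r1 r2) / 2.
have m0 : 0 < Num.min r0 (Num.min r1 r2) by rewrite !lt_min r00 r10 r20.
have r_gt0 : 0 < r by rewrite divr_gt0.
have rm : r < Num.min r0 (Num.min r1 r2) by rewrite /r; lra.
move: rm; rewrite !lt_min => /and3P[rr0 rr1 rr2].
have xE : x + r - x = r by rewrite addrAC subrr add0r.
have yE : y + r - y = r by rewrite addrAC subrr add0r.
have xr : `|x + r - x| = r by rewrite addrAC subrr add0r gtr0_norm.
have yr : `|y + r - y| = r by rewrite addrAC subrr add0r gtr0_norm.
have n0 (a : R) : `|a - a| < r0 by rewrite subrr normr0.
pose D := f (x + r) (y + r) - f (x + r) y - (f x (y + r) - f x y).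
have [z [w [zx wy D1]]] : exists z w, [/\ `|z - x| <= r, `|w - y| <= r &
    D = d2 (d1 f) z w * r * r].
  have [z zx] := @MVT_center _ (fun s => f s (y + r) - f s y)
    (fun s => d1 f s (y + r) - d1 f s y) x (x + r) ltac:(
      move=> z; rewrite xr => zx; apply: is_deriveB;
      apply: (Ck_is_derive1 f0); apply: Hr0 => //; rewrite ?yr//;
      exact: le_lt_trans zx _).
  rewrite xr in zx; rewrite /= => E1.
  have [w wy] := @MVT_center _ (d1 f z) (d2 (d1 f) z) y (y + r) ltac:(
      move=> s; rewrite yr => sy; apply: (Ck_is_derive2 f1); apply: Hr0 => //;
      [exact: le_lt_trans zx _ | exact: le_lt_trans sy _]).
  rewrite yr in wy; move=> E2; exists z, w; split; [exact: zx|exact: wy|].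
  by rewrite /D E1 xE E2 yE.
have [z' [w' [z'x w'y D2]]] : exists z w, [/\ `|z - x| <= r, `|w - y| <= r &
    D = d1 (d2 f) z w * r * r].
  have [w' w'y] := @MVT_center _ (fun s => f (x + r) s - f x s)
    (fun s => d2 f (x + r) s - d2 f x s) y (y + r) ltac:(
      move=> s; rewrite yr => sy; apply: is_deriveB;
      apply: (Ck_is_derive2 f0); apply: Hr0 => //; rewrite ?xr//;
      exact: le_lt_trans sy _).
  rewrite yr in w'y; rewrite /= => E1.
  have [z' z'x] := @MVT_center _ (d2 f ^~ w') (d1 (d2 f) ^~ w') x (x + r) ltac:(
      move=> s; rewrite xr => sx; apply: (Ck_is_derive1 f2); apply: Hr0 => //;
      [exact: le_lt_trans sx _ | exact: le_lt_trans w'y _]).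
  rewrite xr in z'x; move=> E2; exists z', w'; split; [exact: z'x|exact: w'y|].
  have -> : D = f (x + r) (y + r) - f x (y + r) - (f (x + r) y - f x y).
    by rewrite /D; ring.
  rewrite yE in E1; rewrite xE in E2.
  by apply: (etrans E1); congr (_ * _); exact: E2.
have E : d1 (d2 f) z' w' = d2 (d1 f) z w.
  by move: D1; rewrite D2 => /(mulIf (lt0r_neq0 r_gt0))/(mulIf (lt0r_neq0 r_gt0)).
have A1 := Hr1 z w (le_lt_trans zx rr1) (le_lt_trans wy rr1).
have A2 := Hr2 z' w' (le_lt_trans z'x rr2) (le_lt_trans w'y rr2).
move: E A1 A2; move: (d1 (d2 f) z' w') (d2 (d1 f) z w) => A B ->.
move: (d1 (d2 f) x y) (d2 (d1 f) x y) => A' B'; rewrite !ler_norml.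
by move=> /andP[? ?] /andP[? ?]; apply/andP; split; lra.
Qed.

End Partial.

(** * Null sets *)

Section NullSets.
Context {R : realType}.
Local Notation mu := (@lebesgue_measure R).
Local Open Scope ereal_scope.
Let l := (@wlength R idfun).

(** A cover of the image by short intervals pulls back to a cover of [E]: by
    expansion the preimage of an interval of length [l] has diameter at most
    [l / c], hence lies in an interval of length [2 l / c] around any of its
    points.  Neither [E] nor [phi] has to be measurable. *)
Lemma negligible_expanding (E : set R) (phi : R -> R) (c : R) : (0 < c)%R ->
  (forall s t, E s -> E t -> (c * `|s - t| <= `|phi s - phi t|)%R) ->
  mu.-negligible (phi @` E) -> mu.-negligible E.
Proof.
move=> c0 Ephi /negligible_outer_measure phiE0; apply/negligible_outer_measure.
apply/eqP; rewrite eq_le outer_measure_ge0 andbT.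
apply/lee_addgt0Pr => e e0; rewrite add0e.
have : (l^* (phi @` E))%mu < (c * e / 2)%:E.
  by rewrite phiE0 lte_fin divr_gt0// mulr_gt0.
rewrite (outer_measure_open_itv_cover (phi @` E)).
move=> /ereal_inf_lt[/= z [F [Fitv cF] <-] Fe].
have lF0 k : 0 <= l (F k).
  by case: (Fitv k) => -[a b] /= ->; exact: wlength_itv_ge0.
have EF : E `<=` \bigcup_k (E `&` phi @^-1` F k).
  move=> s Es; have [k _ Fk] := cF (phi s) (imageP _ Es).
  by exists k.
apply: (@le_trans _ _ (l^* (\bigcup_k (E `&` phi @^-1` F k)))%mu).
  exact: le_outer_measure.
apply: (le_trans (outer_measure_sigma_subadditive (l^*)%mu _)).
apply: (@le_trans _ _ (\sum_(k <oo) ((2 / c)%:E * l (F k)))); last first.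
  rewrite nneseriesZl// muleC -lee_pdivlMr ?divr_gt0//.
  by rewrite (le_trans (ltW Fe))// -EFinM lee_fin invfM invrK; lra.
apply: lee_nneseries => [k _ _|].
  exact: outer_measure_ge0.
move=> k _.
have [->|/set0P[p [Ep Fp]]] := eqVneq (E `&` phi @^-1` F k) set0.
  by rewrite outer_measure0 mule_ge0// lee_fin divr_ge0// ltW.
have [[a b] /= Fk] := Fitv k.
have ab : (a < b)%R.
  by move: Fp; rewrite /= Fk /= in_itv/= => /andP[]; exact: lt_trans.
pose r := ((b - a) / c)%R.
have r0 : (0 <= r)%R by rewrite divr_ge0 ?subr_ge0// ltW.
apply: (@le_trans _ _ ((l^* `[(p - r)%R, (p + r)%R])%mu)).
  apply: le_outer_measure => s [Es Fs].
  rewrite /= in_itv/= -ler_distl distrC /r ler_pdivlMr// mulrC.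
  apply: (le_trans (Ephi _ _ Ep Es)).
  move: Fp Fs; rewrite /= Fk /= !in_itv/= => /andP[? ?] /andP[? ?].
  by rewrite ler_norml; apply/andP; split; lra.
rewrite -[X in X <= _]/(mu _) lebesgue_measure_itv/= Fk /l wlength_itv/=.
rewrite !lte_fin ab; case: ifPn => _; last first.
  by rewrite mule_ge0// lee_fin ?divr_ge0 ?subr_ge0// ltW.
by rewrite -!EFinB -EFinM lee_fin /r; lra.
Qed.

End NullSets.

Section NullPreimages.
Context {R : realType}.
Local Notation mu := (@lebesgue_measure R).

Lemma derivative_neq0_expanding (phi : R -> R) (t d : R) :
  is_derive t 1 phi d -> d != 0 ->
  exists n : nat, forall s, `|s - t| < n.+1%:R^-1 ->
    n.+1%:R^-1 * `|s - t| <= `|phi s - phi t|.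
Proof.
move=> phid d0; have dd0 : 0 < `|d| / 2 by rewrite divr_gt0// normr_gt0.
have [e e0 He] := (is_derive1P _ _ _).1 phid _ dd0.
near \oo => n.
have ne : n.+1%:R^-1 < e by near: n; exact: (near_infty_natSinv_lt (PosNum e0)).
have nd : n.+1%:R^-1 < `|d| / 2.
  by near: n; exact: (near_infty_natSinv_lt (PosNum dd0)).
exists n => s sn; have := He s (lt_trans sn ne).
have := ler_normB (phi s - phi t) (phi s - phi t - d * (s - t)).
rewrite [X in `|X|](_ : _ = d * (s - t)); last by ring.
rewrite normrM => H1 H2.
apply: (@le_trans _ _ (`|d| / 2 * `|s - t|)); first by rewrite ler_wpM2r// ltW.
by rewrite -(lerD2r (`|d| / 2 * `|s - t|)) -mulrDl -splitr (le_trans H1)// lerD2l.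
Unshelve. all: by end_near. Qed.

(** A function spends almost no time in a null set, except where it is
    stationary: the points with nonzero derivative split into countably many
    pieces, indexed by an expansion constant [1 / n.+1] and a cell of the grid
    of that step, on each of which the function is expanding. *)
Lemma negligible_critical_preimage (N : set R) (phi : R -> R) :
  mu.-negligible N ->
  mu.-negligible [set t : R | exists2 d : R, is_derive t 1 phi d & d != 0 /\ N (phi t)].
Proof.
move=> N0; set E := (X in _.-negligible X).
pose P n j := [set t | [/\ E t,
  forall s, `|s - t| < n.+1%:R^-1 -> n.+1%:R^-1 * `|s - t| <= `|phi s - phi t| &
  pickle (Num.floor (t * n.+1%:R)) = j]].
apply: (@negligibleS _ _ _ mu (\bigcup_n \bigcup_j P n j)).
  move=> t Et; have [d phid [d0 _]] := Et.
  have [n Hn] := derivative_neq0_expanding phid d0.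
  by exists n => //; exists (pickle (Num.floor (t * n.+1%:R))).
apply: negligible_bigcup => n; apply: negligible_bigcup => j.
apply: (@negligible_expanding _ _ phi n.+1%:R^-1); first by rewrite invr_gt0.
  move=> s t [Es Hs sj] [Et Ht tj]; apply: Ht.
  have /pcan_inj/(_ _ _ (etrans sj (esym tj))) fE := (@pickleK int).
  have n0 : 0 < n.+1%:R :> R by [].
  rewrite -[ltRHS]mul1r ltr_pdivlMr// -[X in _ * X](gtr0_norm n0) -normrM mulrBl.
  have := floor_itv (s * n.+1%:R); rewrite fE => /andP[s1 s2].
  have := floor_itv (t * n.+1%:R) => /andP[t1 t2].
  rewrite intrD in s2 t2.
  by rewrite ltr_norml; apply/andP; split; lra.
apply: negligibleS N0 => _ [t [[d _ [_ Nt]] _ _] <-].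
exact: Nt.
Qed.

(** Fubini: both families of sections compute the measure of [A]. *)
Lemma ae_ysection0 (A : set (R * R)) : measurable A ->
  (forall x, mu (xsection A x) = 0%E) ->
  {ae mu, forall t, mu (ysection A t) = 0%E}.
Proof.
move=> mA A0.
have := @indic_fubini_tonelli _ _ _ _ R mu mu A mA.
rewrite indic_fubini_tonelli_FE// indic_fubini_tonelli_GE//.
rewrite integral0_eq//= => /esym H.
have : (\int[mu]_y `|(mu \o ysection A) y| = 0)%E.
  by rewrite -[RHS]H; apply: eq_integral => y _; rewrite gee0_abs.
move/(ae_eq_integral_abs mu measurableT); have := measurable_fun_ysection mu mA.
move=> /[swap] /[apply].
by apply: filterS => y /(_ I).
Qed.

(** An open set of the plane is a countable union of rational squares. *)
Lemma open_measurable_prod (U : set (R * R)) : open U -> measurable U.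
Proof.
move=> oU.
pose B (q : rat * rat * nat) : set (R * R) :=
  ball (ratr q.1.1 : R) q.2.+1%:R^-1 `*` ball (ratr q.1.2 : R) q.2.+1%:R^-1.
have -> : U = \bigcup_(q in [set q | B q `<=` U]) B q.
  apply/seteqP; split => [z Uz|z [q qU]]; last exact: qU.
  have [e e0 zeU] : exists2 e : R, 0 < e & ball z e `<=` U.
    by apply/nbhs_ballP; exact: open_nbhs_nbhs.
  have e20 : 0 < e / 2 by rewrite divr_gt0.
  near \oo => n.
  have ne : n.+1%:R^-1 < e / 2.
    by near: n; exact: (near_infty_natSinv_lt (PosNum e20)).
  have n0 : 0 < n.+1%:R^-1 :> R by rewrite invr_gt0.
  have [p /andP[]] : exists q : rat, (z.1 < ratr q) && (ratr q < z.1 + n.+1%:R^-1).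
    have [q qP] := @rat_in_itvoo R z.1 (z.1 + n.+1%:R^-1) ltac:(by rewrite ltrDl).
    by exists q; move: qP; rewrite in_itv.
  have [q /andP[]] : exists q : rat, (z.2 < ratr q) && (ratr q < z.2 + n.+1%:R^-1).
    have [q qP] := @rat_in_itvoo R z.2 (z.2 + n.+1%:R^-1) ltac:(by rewrite ltrDl).
    by exists q; move: qP; rewrite in_itv.
  move=> q1 q2 p1 p2.
  exists (p, q, n); rewrite /B /=;
    move: (ratr p : R) (ratr q : R) (n.+1%:R^-1 : R) n0 ne p1 p2 q1 q2.
  move=> {}p {}q r r0 re p1 p2 q1 q2.
    move=> y [/=]; rewrite /ball/= => y1 y2; apply: zeU; split; rewrite /ball/=.
      by move: y1; rewrite !ltr_norml => /andP[? ?]; apply/andP; split; lra.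
    by move: y2; rewrite !ltr_norml => /andP[? ?]; apply/andP; split; lra.
  by rewrite /ball/=; split; rewrite ltr_norml/=; apply/andP; split; lra.
rewrite bigcup_mkcond.
apply: countable_bigcupT_measurable => [|q]; first exact: countableP.
by case: ifPn => // _; apply: measurableX; exact: measurable_ball.
Unshelve. all: by end_near. Qed.

Lemma open_continuous_measurable_prod (U : set (R * R)) (f : R * R -> R) :
  open U -> {within U, continuous f} -> measurable_fun U f.
Proof.
move=> oU cf; apply: (measurability _ (RGenOInfty.measurableE R)).
move=> _ [_ [a ->] <-]; apply: open_measurable_prod.
have cf' : {in U, continuous f} by rewrite -continuous_open_subspace.
rewrite openE => z [Uz fz].
have Uf : nbhs z (f @^-1` `]a, +oo[).
  apply: cf'; first exact/mem_set.
  by apply: open_nbhs_nbhs; split => //; exact: interval_open.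
have : nbhs z U by exact: open_nbhs_nbhs.
by move=> Uz'; near=> y; split; near: y.
Unshelve. all: by end_near. Qed.

End NullPreimages.

(** * Integrals of almost everywhere bounded functions *)

Section AlmostEverywhere.
Context {R : realType}.
Local Notation mu := (@lebesgue_measure R).
Implicit Types (P Q : R -> Prop).

Lemma ae_imply P Q : (forall x, P x -> Q x) ->
  {ae mu, forall x, P x} -> {ae mu, forall x, Q x}.
Proof. by move=> PQ; exact: (@filterS _ _ (ae_filter_ringOfSetsType mu)). Qed.

Lemma ae_and P Q : {ae mu, forall x, P x} -> {ae mu, forall x, Q x} ->
  {ae mu, forall x, P x /\ Q x}.
Proof. exact: (@filterI _ _ (ae_filter_ringOfSetsType mu)). Qed.

End AlmostEverywhere.

Section FiniteDomain.
Context {R : realType}.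
Local Notation mu := (@lebesgue_measure R).
Variables (D : set R) (mD : measurable D) (finD : (mu D < +oo)%E).
Implicit Types (f g : R -> R).

Lemma bounded_ae_integrable f (M : R) : measurable_fun D f ->
  {ae mu, forall x, D x -> `|f x| <= M} -> mu.-integrable D (EFin \o f).
Proof.
move=> mf fM; apply/integrableP; split; first exact/measurable_EFinP.
apply: (@le_lt_trans _ _ (\int[mu]_(x in D) (`|M|%:E))%E).
  apply: ae_ge0_le_integral => //.
  - by apply/measurable_EFinP; exact: measurableT_comp.
  - move: fM; apply: ae_imply => x fx Dx; rewrite lee_fin (le_trans (fx Dx))//.
    exact: ler_norm.
rewrite integral_cst//; exact: lte_mul_pinfty.
Qed.

Lemma ae_eq_Rintegral f g : measurable_fun D f -> measurable_fun D g ->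
  {ae mu, forall x, D x -> f x = g x} ->
  \int[mu]_(x in D) f x = \int[mu]_(x in D) g x.
Proof.
move=> mf mg fg; congr fine; apply: ae_eq_integral => //.
- exact/measurable_EFinP.
- exact/measurable_EFinP.
- by move: fg; apply: ae_imply => x fgx Dx; rewrite fgx.
Qed.

Lemma ae_le_Rintegral f g : mu.-integrable D (EFin \o f) ->
  mu.-integrable D (EFin \o g) ->
  {ae mu, forall x, D x -> f x <= g x} ->
  \int[mu]_(x in D) f x <= \int[mu]_(x in D) g x.
Proof.
move=> fi gi fg.
have mf : measurable_fun D f by apply/measurable_EFinP; case/integrableP: fi.
have mg : measurable_fun D g by apply/measurable_EFinP; case/integrableP: gi.
rewrite -subr_ge0 -RintegralB//.
rewrite (_ : \int[mu]_(x in D) _ = \int[mu]_(x in D) `|g x - f x|).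
  exact: Rintegral_ge0.
apply: ae_eq_Rintegral.
- exact: measurable_funB.
- by apply: measurableT_comp => //; exact: measurable_funB.
- by move: fg; apply: ae_imply => x fgx /fgx; rewrite -subr_ge0 => /ger0_norm ->.
Qed.

(** Dominated convergence along a continuous parameter. *)
Lemma Rintegral_cvg_dnbhs (q : R -> R -> R) g (t r L : R) : 0 < r ->
  (forall s, `|s - t| < r -> s != t -> measurable_fun D (q s)) ->
  {ae mu, forall x, D x -> forall s, `|s - t| < r -> s != t -> `|q s x| <= L} ->
  measurable_fun D g ->
  {ae mu, forall x, D x -> q s x @[s --> t^'] --> g x} ->
  \int[mu]_(x in D) q s x @[s --> t^'] --> \int[mu]_(x in D) g x.
Proof.
move=> r0 mq qL mg qg; apply/cvgr_dnbhsP => v [vt vcvg].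
have [N HN] : exists N, forall n, `|v (n + N)%N - t| < r.
  move/cvgrPdist_lt : vcvg => /(_ _ r0)[N _ HN]; exists N => n.
  by rewrite distrC; apply: HN => /=; rewrite leq_addl.
rewrite -(cvg_shiftn N); apply: fine_cvg.
have iL : mu.-integrable D (EFin \o cst L).
  by apply: (@bounded_ae_integrable _ `|L|) => //; apply: aeW.
have [|||//||gi _] := @dominated_convergence _ _ _ mu _ mD
  (fun n x => (q (v (n + N)%N) x)%:E) (EFin \o g) (EFin \o cst L).
- by move=> n; apply/measurable_EFinP; exact: mq.
- exact/measurable_EFinP.
- move: qg; apply: ae_imply => x + Dx => /(_ Dx)/cvgr_dnbhsP.
  move=> /(_ (fun n => v (n + N)%N)) H; apply: cvg_EFin; first exact: nearW.
  by apply: H; split=> //; rewrite cvg_shiftn.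
- by move: qL; apply: ae_imply => x + n Dx => /(_ Dx) H; rewrite lee_fin; exact: H.
by rewrite /Rintegral fineK// integrable_fin_num.
Qed.

(** Only a Lipschitz bound in the parameter is asked, and the derivative may
    fail to exist on a null set, so that [f] may be a shift of a Lipschitz
    function. *)
Lemma is_derive_Rintegral (f : R -> R -> R) g (t r B L : R) : 0 < r ->
  (forall s, `|s - t| < r -> measurable_fun D (f s)) ->
  (forall s x, `|s - t| < r -> D x -> `|f s x| <= B) ->
  (forall s x, `|s - t| < r -> D x -> `|f s x - f t x| <= L * `|s - t|) ->
  measurable_fun D g ->
  {ae mu, forall x, D x -> is_derive t 1 (f ^~ x) (g x)} ->
  is_derive t 1 (fun s => \int[mu]_(x in D) f s x) (\int[mu]_(x in D) g x).
Proof.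
move=> r0 mf fB fL mg fg; apply/is_derive_quotientP.
have tt : `|t - t| < r by rewrite subrr normr0.
have fi s : `|s - t| < r -> mu.-integrable D (EFin \o f s).
  move=> sr; apply: (@bounded_ae_integrable _ B); first exact: mf.
  by apply: aeW => x Dx; exact: fB.
have qE : \forall s \near t^',
    \int[mu]_(x in D) ((s - t)^-1 * (f s x - f t x)) =
    (s - t)^-1 * (\int[mu]_(x in D) f s x - \int[mu]_(x in D) f t x).
  exists r => // s /=; rewrite distrC => sr st.
  rewrite -RintegralB ?RintegralZl//; try exact: fi.
  apply: (@bounded_ae_integrable _ (B + B)).
    by apply: measurable_funB; exact: mf.
  by apply: aeW => x Dx; rewrite (le_trans (ler_normB _ _))// lerD// fB.
apply: (cvg_trans (@near_eq_cvg _ _ (t^') _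
  (fun s => \int[mu]_(x in D) ((s - t)^-1 * (f s x - f t x))) _ qE)).
apply: (@Rintegral_cvg_dnbhs _ _ _ r L) => //.
- move=> s sr _; apply: measurable_funM => //.
  by apply: measurable_funB; exact: mf.
- apply: aeW => x Dx s sr st.
  rewrite normrM normfV mulrC ler_pdivrMr ?normr_gt0 ?subr_eq0//.
  exact: fL.
- by move: fg; apply: ae_imply => x + Dx => /(_ Dx)/is_derive_quotientP.
Qed.

End FiniteDomain.

Section FTC.
Context {R : realType}.
Local Notation mu := (@lebesgue_measure R).

Lemma continuous_bounded_itv (f : R -> R) (a b : R) : continuous f ->
  exists M : R, forall x, `[a, b]%classic x -> `|f x| <= M.
Proof.
move=> cf; have : {within `[a, b], continuous f}.
  by apply: continuous_subspaceT => ?; exact: cf.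
move/continuous_compact => /(_ (@segment_compact _ _ _)).
move/compact_bounded => -[M [_ HM]]; exists (`|M| + 1) => x xab.
by apply: (HM (`|M| + 1)); [rewrite (le_lt_trans (ler_norm _))// ltrDl|exists x].
Qed.

Lemma itv_finite_measure (a b : R) : (mu (`[a, b]%classic : set R) < +oo)%E.
Proof. by rewrite lebesgue_measure_itv/=; case: ifP => _; rewrite ?ltry. Qed.

Lemma is_derive_primitive (f : R -> R) (a x : R) : a < x -> continuous f ->
  is_derive x 1 (fun y => \int[mu]_(s in `[a, y]) f s) (f x).
Proof.
move=> ax cf.
have [|||| d1F d2F] := @continuous_FTC1_closed R f a x (x + 1).
- by rewrite ltrDl.
- apply: continuous_compact_integrable; first exact: segment_compact.
  by apply: continuous_subspaceT => ?; exact: cf.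
- exact: ax.
- exact: cf.
- by rewrite -d2F; exact: derivable_is_derive1.
Qed.

Lemma Rintegral_FTC2 (f F : R -> R) (a b : R) : a <= b -> continuous f ->
  (forall x, a <= x <= b -> is_derive x 1 F (f x)) ->
  \int[mu]_(x in `[a, b]) f x = F b - F a.
Proof.
rewrite le_eqVlt => /predU1P[<- _ _|ab cf Ff].
  by rewrite set_itv1 Rintegral_set1 subrr.
have cF x : a <= x <= b -> {for x, continuous F}.
  by move=> xab; exact: is_derive1_continuous (Ff _ xab).
rewrite /Rintegral (@continuous_FTC2 _ _ F)//.
- by apply: continuous_subspaceT => ?; exact: cf.
- split.
  + by move=> x; rewrite in_itv/= => /andP[ax xb]; have [] := Ff x; rewrite ?ltW.
  + apply: cvg_at_right_filter; apply: cF; by rewrite lexx ltW.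
  + apply: cvg_at_left_filter; apply: cF; by rewrite lexx ltW.
- move=> x; rewrite in_itv/= => /andP[ax xb]; apply: is_derive_derive1.
  by apply: Ff; rewrite !ltW.
Qed.

(** The integral of [f] from [a + s] to [b + s] is differentiated at [s = 0] in
    two ways: through a primitive of the continuous function [f], which gives
    [f b - f a], and under the integral sign, which gives the integral of the
    almost everywhere derivative. *)
Lemma FTC_lipschitz (f g : R -> R) (a b L : R) : a <= b ->
  (forall x y, `|f x - f y| <= L * `|x - y|) ->
  measurable_fun `[a, b] g ->
  {ae mu, forall x, a <= x <= b -> is_derive x 1 f (g x)} ->
  \int[mu]_(x in `[a, b]) g x = f b - f a.
Proof.
move=> ab fL mg fg.
have cf := lipschitz_continuous fL.
(* the base point [a - 2] leaves room for shifts [s] of size less than 1 *)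
pose Q y := \int[mu]_(s in `[a - 2, y]) f s.
have dQ (x : R) : a - 2 < x -> is_derive x 1 Q (f x).
  by move=> ax; exact: is_derive_primitive.
have QE s : `|s - 0| < 1 -> \int[mu]_(x in `[a, b]) f (x + s) = Q (b + s) - Q (a + s).
  rewrite subr0 ltr_norml => /andP[s1 s2].
  apply: (@Rintegral_FTC2 (fun x => f (x + s)) (fun x => Q (x + s))) => //.
    move=> x; apply: continuous_comp; last exact: cf.
    by apply: cvgD; [exact: cvg_id|exact: cvg_cst].
  move=> x /andP[ax xb]; rewrite -[f _]mulr1.
  apply: (@is_derive1_comp _ Q (fun x => x + s)).
    by apply: dQ; lra.
  by apply: is_derive_eq; rewrite addr0.
have shift (x : R) : is_derive (0 : R) 1 (fun s : R => x + s) 1.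
  apply/is_derive1P => e e0; exists 1 => // s _.
  rewrite (_ : x + s - (x + 0) - 1 * (s - 0) = 0); last by ring.
  by rewrite normr0 mulr_ge0// ltW.
have d1 : is_derive (0 : R) 1 (fun s : R => Q (b + s) - Q (a + s)) (f b - f a).
  apply: is_deriveB.
    rewrite -[f b]mulr1; apply: (@is_derive1_comp _ Q (fun s => b + s)) => //.
    by rewrite addr0; apply: dQ; lra.
  rewrite -[f a]mulr1; apply: (@is_derive1_comp _ Q (fun s => a + s)) => //.
  by rewrite addr0; apply: dQ; lra.
have [M HM] := continuous_bounded_itv (a - 1) (b + 1) cf.
have d2 : is_derive (0 : R) 1 (fun s : R => \int[mu]_(x in `[a, b]) f (x + s))
    (\int[mu]_(x in `[a, b]) g x).
  apply: (@is_derive_Rintegral _ _ _ (itv_finite_measure a b) (fun s x => f (x + s))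
    g 0 1 M L) => //.
  - move=> s _; apply: measurable_funTS; apply: continuous_measurable_fun.
    move=> x; apply: continuous_comp; last exact: cf.
    by apply: cvgD; [exact: cvg_id|exact: cvg_cst].
  - move=> s x; rewrite subr0 ltr_norml => /andP[? ?].
    rewrite /= in_itv/= => /andP[? ?]; apply: HM; rewrite /= in_itv/=.
    by apply/andP; split; lra.
  - move=> s x _ _; rewrite addr0 subr0 (le_trans (fL _ _))//.
    by rewrite addrAC subrr add0r.
  - move: fg; apply: ae_imply => x xg /=; rewrite in_itv/= => /xg fx.
    rewrite -[g x]mulr1; apply: (@is_derive1_comp _ f (fun s => x + s)) => //.
    by rewrite addr0.
rewrite -(is_derive_derive1 d1) -(is_derive_derive1 d2) !derive1E.
apply: near_eq_derive.
by exists 1 => //= s /=; rewrite distrC => /QE.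
Qed.

End FTC.

(** * Sobolev functions on the line *)

Section Spline.
Context {R : realType}.
Implicit Types (x y : R).

Definition pos_part y : R := Num.max 0 y.

(** The quadratic spline rising from 0 at 0 to 1 at 2: a C^1 substitute for the
    Heaviside function, with derivative [hat]. *)
Definition ramp y : R :=
  (pos_part y ^+ 2 - 2 * pos_part (y - 1) ^+ 2 + pos_part (y - 2) ^+ 2) / 2.

Definition hat y : R :=
  pos_part y - 2 * pos_part (y - 1) + pos_part (y - 2).

Lemma pos_partP y : (0 <= y /\ pos_part y = y) \/ (y <= 0 /\ pos_part y = 0).
Proof.
rewrite /pos_part; have [y0|/ltW y0] := leP 0 y.
  by left.
by right.
Qed.

Lemma pos_part_continuous : continuous pos_part.
Proof.
apply: (@lipschitz_continuous _ _ 1) => x y; rewrite mul1r.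
have [[? ->]|[? ->]] := pos_partP x; have [[? ->]|[? ->]] := pos_partP y => //.
- by rewrite subr0 ler_norml; apply/andP; split; have := ler_norm (x - y); lra.
- by rewrite sub0r ler_norml; apply/andP; split; have := ler_norm (y - x); rewrite distrC; lra.
- by rewrite subrr normr0.
Qed.

Lemma is_derive_pos_part_sqr (t : R) :
  is_derive t 1 (fun y => pos_part y ^+ 2) (2 * pos_part t).
Proof.
apply/is_derive1P => e e0; exists e => // s se.
apply: (@le_trans _ _ ((s - t) ^+ 2)); last first.
  by rewrite -real_normK ?num_real// expr2 ler_wpM2r// ltW.
rewrite ler_norml; have := sqr_ge0 (s - t); have := sqr_ge0 s.
have [[s0 ->]|[s0 ->]] := pos_partP s; have [[t0 ->]|[t0 ->]] := pos_partP t.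
- by rewrite !expr2 => ? ?; apply/andP; split; lra.
- have := mulr_ge0_le0 s0 t0; have := sqr_ge0 t.
  by rewrite !expr2 => ? ? ? ?; apply/andP; split; lra.
- have := mulr_ge0_le0 t0 s0; have := sqr_ge0 t.
  by rewrite !expr2 => ? ? ? ?; apply/andP; split; lra.
- by rewrite !expr2 => ? ?; apply/andP; split; lra.
Qed.

Lemma is_derive_ramp (t : R) : is_derive t 1 ramp (hat t).
Proof.
have sh (c : R) : is_derive t 1 (fun y => pos_part (y - c) ^+ 2) (2 * pos_part (t - c)).
  rewrite -[2 * _]mulr1.
  apply: (@is_derive1_comp _ (fun y => pos_part y ^+ 2) (fun y => y - c)).
    exact: is_derive_pos_part_sqr.
  apply/is_derive1P => e e0; exists 1 => // s _.
  rewrite (_ : s - c - (t - c) - 1 * (s - t) = 0); last by ring.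
  by rewrite normr0 mulr_ge0// ltW.
have -> : ramp = (fun y => 2^-1 * (pos_part (y - 0) ^+ 2
    + (- 2) * pos_part (y - 1) ^+ 2 + pos_part (y - 2) ^+ 2)).
  by apply/funext => y; rewrite /ramp subr0; ring.
have -> : hat t = 2^-1 * (2 * pos_part (t - 0) + (- 2) * (2 * pos_part (t - 1))
   + 2 * pos_part (t - 2)).
  by rewrite /hat subr0; field.
by apply: is_deriveZ.
Qed.

Lemma hat_continuous : continuous hat.
Proof.
have sh (c : R) : continuous (fun y => pos_part (y - c)).
  move=> x; apply: (@continuous_comp _ _ _ (fun y => y - c) pos_part);
    last exact: pos_part_continuous.
  by apply: cvgB; [exact: cvg_id|exact: cvg_cst].
apply: continuous_addf; last exact: sh.
apply: continuous_addf; first exact: pos_part_continuous.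
apply: continuous_oppf; apply: continuous_mulf; last exact: sh.
by move=> x; exact: cvg_cst.
Qed.

Lemma hat_ge0_le1 y : 0 <= hat y <= 1.
Proof.
rewrite /hat.
have [[? ->]|[? ->]] := pos_partP y; have [[? ->]|[? ->]] := pos_partP (y - 1);
have [[? ->]|[? ->]] := pos_partP (y - 2); by apply/andP; split; lra.
Qed.

Lemma hat_out y : y <= 0 \/ 2 <= y -> hat y = 0.
Proof.
rewrite /hat; case=> y0;
have [[? ->]|[? ->]] := pos_partP y; have [[? ->]|[? ->]] := pos_partP (y - 1);
have [[? ->]|[? ->]] := pos_partP (y - 2); lra.
Qed.

Lemma ramp_eq0 y : y <= 0 -> ramp y = 0.
Proof.
rewrite /ramp => y0.
have [[? ->]|[? ->]] := pos_partP y; have [[? ->]|[? ->]] := pos_partP (y - 1);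
have [[? ->]|[? ->]] := pos_partP (y - 2); nra.
Qed.

Lemma ramp_eq1 y : 2 <= y -> ramp y = 1.
Proof.
by move=> y2; rewrite /ramp /pos_part !max_r; [field|lra|lra|lra].
Qed.

Lemma ramp_ge0_le1 y : 0 <= ramp y <= 1.
Proof.
have [y0|y0] := leP y 0; first by rewrite ramp_eq0// lexx ler01.
have [y2|y2] := leP 2 y; first by rewrite ramp_eq1// lexx ler01.
rewrite /ramp.
have [[? ->]|[? ->]] := pos_partP y; have [[? ->]|[? ->]] := pos_partP (y - 1);
have [[? ->]|[? ->]] := pos_partP (y - 2); apply/andP; split; nra.
Qed.

End Spline.

Section Mollifier.
Context {R : realType}.
Local Notation mu := (@lebesgue_measure R).

(** For [d > 0], a continuous probability density supported between [c] and
    [c + 2 * d]. *)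
Definition mollifier (c d x : R) : R := d^-1 * hat (d^-1 * (x - c)).

Lemma is_derive_ramp_scaled (c d x : R) :
  is_derive x 1 (fun y => ramp (d^-1 * (y - c))) (mollifier c d x).
Proof.
rewrite /mollifier mulrC.
apply: (@is_derive1_comp _ ramp (fun y => d^-1 * (y - c))).
  exact: is_derive_ramp.
apply/is_derive1P => e e0; exists 1 => // s _.
rewrite (_ : d^-1 * (s - c) - d^-1 * (x - c) - d^-1 * (s - x) = 0); last by ring.
by rewrite normr0 mulr_ge0// ltW.
Qed.

Lemma mollifier_continuous (c d : R) : continuous (mollifier c d).
Proof.
move=> x; apply: cvgM; first exact: cvg_cst.
apply: (@continuous_comp _ _ _ (fun y => d^-1 * (y - c)) hat);
  last exact: hat_continuous.
apply: cvgM; first exact: cvg_cst.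
by apply: cvgB; [exact: cvg_id|exact: cvg_cst].
Qed.

Lemma mollifier_ge0_le (c d x : R) : 0 < d -> 0 <= mollifier c d x <= d^-1.
Proof.
move=> d0; have /andP[h0 h1] := hat_ge0_le1 (d^-1 * (x - c)).
by rewrite /mollifier mulr_ge0 ?invr_ge0 ?(ltW d0)//= ler_piMr ?invr_ge0 ?(ltW d0).
Qed.

Lemma mollifier_out (c d x : R) : 0 < d -> x <= c \/ c + 2 * d <= x ->
  mollifier c d x = 0.
Proof.
move=> d0 xc; rewrite /mollifier hat_out ?mulr0//.
case: xc => xc; [left|right].
  by rewrite pmulr_rle0 ?invr_gt0// subr_le0.
by rewrite mulrC ler_pdivlMr//; lra.
Qed.

Lemma Rintegral_mollifier (a b c d : R) : a <= c -> 0 < d -> c + 2 * d <= b ->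
  \int[mu]_(x in `[a, b]) mollifier c d x = 1.
Proof.
move=> ac d0 cb.
transitivity (ramp (d^-1 * (b - c)) - ramp (d^-1 * (a - c))).
  apply: (@Rintegral_FTC2 _ _ (fun y => ramp (d^-1 * (y - c)))).
  - lra.
  - exact: mollifier_continuous.
  - by move=> x _; exact: is_derive_ramp_scaled.
rewrite ramp_eq1 ?ramp_eq0 ?subr0//.
  by rewrite pmulr_rle0 ?invr_gt0// subr_le0.
by rewrite mulrC ler_pdivlMr//; lra.
Qed.

Lemma continuous_measurable (f : R -> R) (D : set R) :
  continuous f -> measurable_fun D f.
Proof. by move=> cf; apply: measurable_funTS; exact: continuous_measurable_fun. Qed.

(** The mollifier has mass 1 and is at most [d^-1] on a ball of measure [4 d],
    whence the factor 4. *)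
Lemma mollifier_davg (f : R -> R) (a b c d K : R) :
  measurable_fun setT f -> {ae mu, forall x, `|f x| <= K} ->
  a <= c -> 0 < d -> c + 2 * d <= b ->
  (`|\int[mu]_(x in `[a, b]) (f x * mollifier c d x) - f c|%:E
     <= 4%:E * davg f c (2 * d))%E.
Proof.
move=> mf fK ac d0 cb.
have mD : measurable (`[a, b]%classic : set R) by exact: measurable_itv.
have fD := itv_finite_measure a b.
have mB : measurable (ball c (2 * d) : set R) by exact: measurable_ball.
have mm (D : set R) : measurable_fun D (mollifier c d).
  exact: continuous_measurable (@mollifier_continuous c d).
have mfD (D : set R) : measurable_fun D f by exact: measurable_funTS.
have mol := @mollifier_ge0_le c d ^~ d0.
have nm x : `|mollifier c d x| <= d^-1.
  by have /andP[m0 m1] := mol x; rewrite ger0_norm.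
have i1 : mu.-integrable `[a, b] (EFin \o (fun x => f x * mollifier c d x)).
  apply: (@bounded_ae_integrable _ _ mD fD _ (K * d^-1)).
    exact: measurable_funM.
  move: fK; apply: ae_imply => x fx _.
  by rewrite normrM ler_pM.
have i2 : mu.-integrable `[a, b] (EFin \o (fun x => f c * mollifier c d x)).
  apply: (@bounded_ae_integrable _ _ mD fD _ (`|f c| * d^-1)).
    by apply: measurable_funM => //; exact: measurable_cst.
  by apply: aeW => x _; rewrite normrM ler_wpM2l.
have i3 : mu.-integrable `[a, b] (EFin \o mollifier c d).
  apply: (@bounded_ae_integrable _ _ mD fD _ d^-1) => //.
  by apply: aeW => x _.
have mdiff (D : set R) : measurable_fun D
    (fun x => f x * mollifier c d x - f c * mollifier c d x).
  by apply: measurable_funB; apply: measurable_funM.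
have mdiffn (D : set R) : measurable_fun D
    (fun x => `|f x * mollifier c d x - f c * mollifier c d x|).
  by apply: measurableT_comp => //; exact: mdiff.
have mabs1 (D : set R) : measurable_fun D (fun x => `|f x - f c|).
  by apply: measurableT_comp => //; exact: measurable_funB.
have mabs (D : set R) : measurable_fun D (fun x => d^-1 * `|f x - f c|).
  exact: measurable_funM.
have -> : \int[mu]_(x in `[a, b]) (f x * mollifier c d x) - f c =
    \int[mu]_(x in `[a, b]) (f x * mollifier c d x - f c * mollifier c d x).
  by rewrite RintegralB// RintegralZl// Rintegral_mollifier// mulr1.
have dK : {ae mu, forall x, `[a, b]%classic x ->
    `|f x * mollifier c d x - f c * mollifier c d x|
      <= K * d^-1 + `|f c| * d^-1}.
  move: fK; apply: ae_imply => x fx _.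
  by rewrite (le_trans (ler_normB _ _))// lerD// normrM ler_pM.
have idiff := bounded_ae_integrable mD fD (mdiff _) dK.
have iabs : mu.-integrable `[a, b]
    (EFin \o (fun x => `|f x * mollifier c d x - f c * mollifier c d x|)).
  apply: (@bounded_ae_integrable _ _ mD fD _ (K * d^-1 + `|f c| * d^-1)).
    by apply: measurableT_comp => //; exact: mdiff.
  by move: dK; apply: ae_imply => x + Dx => /(_ Dx); rewrite normr_id.
apply: (@le_trans _ _ (\int[mu]_(x in `[a, b])
    `|f x * mollifier c d x - f c * mollifier c d x|)%:E).
  by rewrite lee_fin; apply: le_normr_Rintegral.
rewrite /Rintegral fineK; last by apply: integrable_fin_num.
apply: (@le_trans _ _ (\int[mu]_(x in ball c (2 * d)%R) (d^-1 * `|f x - f c|)%:E)%E).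
  rewrite integral_mkcond [leRHS]integral_mkcond.
  apply: ge0_le_integral => //=.
  - by move=> x _; rewrite erestrict_ge0.
  - apply/(measurable_restrictT _ _).1 => //.
    by apply/measurable_EFinP; exact: mdiffn.
  - apply/(measurable_restrictT _ _).1; first exact: mB.
    by apply/measurable_EFinP; exact: mabs.
  - move=> x _; rewrite !patchE.
    have [xb|xb] := boolP (x \in (ball c (2 * d) : set R)); last first.
      rewrite mollifier_out// ?mulr0 ?subrr ?normr0.
        by case: ifP.
      move: xb; rewrite notin_setE/= /ball/= => /negP; rewrite -leNgt.
      by have [|] := leP x c => ? H; [left|right]; rewrite // ltr0_norm in H; lra.
    case: ifP => _; last by rewrite lee_fin mulr_ge0// invr_ge0 ltW.
    rewrite lee_fin -mulrBl normrM mulrC ler_wpM2r//.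
under eq_integral do rewrite EFinM.
rewrite ge0_integralZl//; last 2 first.
- by apply/measurable_EFinP; exact: mabs1.
- by rewrite lee_fin invr_ge0 ltW.
rewrite /davg /iavg lebesgue_measure_ball ?mulr_ge0 ?(ltW d0)//.
rewrite inver ifF; last by apply/negbTE; rewrite mulrn_eq0/= mulf_neq0// gt_eqF.
rewrite muleA -EFinM (_ : 4 * (2 * d *+ 2)^-1 = d^-1)%R//.
rewrite -mulr_natl; field; lra.
Qed.

End Mollifier.

Section WeakDerivative.
Context {R : realType}.
Local Notation mu := (@lebesgue_measure R).

Lemma mollifier_cvg (f : R -> R) (a b c K : R) :
  measurable_fun setT f -> {ae mu, forall x, `|f x| <= K} ->
  a <= c -> c < b -> lebesgue_pt f c ->
  \int[mu]_(x in `[a, b]) (f x * mollifier c `|s| x) @[s --> (0:R)^'] --> f c.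
Proof.
move=> mf fK ac cb fc.
have e40 (e : R) : 0 < e -> 0 < e / 4 by move=> ?; rewrite divr_gt0.
apply/cvgrPdist_le => e e0.
have /fine_cvgP[[r1 /= r10 fin1]] := fc.
move=> /cvgrPdist_le/(_ (e / 4) (e40 e e0)) [r2 /= r20 H2].
pose r := Num.min (b - c) (Num.min r1 r2) / 2.
have m0 : 0 < Num.min (b - c) (Num.min r1 r2).
  by rewrite !lt_min subr_gt0 cb r10.
exists r; first by rewrite /= divr_gt0.
move=> s /=; rewrite sub0r normrN => sr s0.
have d0 : 0 < `|s| by rewrite normr_gt0.
have : 2 * `|s| < Num.min (b - c) (Num.min r1 r2).
  by move: sr; rewrite ltr_pdivlMr// mulrC.
rewrite !lt_min => /and3P[sb sr1 sr2].
have d20 : 0 < 2 * `|s| by rewrite mulr_gt0.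
have fin : davg f c (2 * `|s|) \is a fin_num.
  by apply: fin1 => //=; rewrite sub0r normrN gtr0_norm.
have dle : `|0 - fine (davg f c (2 * `|s|))| <= e / 4.
  by apply: H2 => //=; rewrite sub0r normrN gtr0_norm.
rewrite distrC -lee_fin.
have -> : e%:E = (4%:E * (e / 4)%:E)%E.
  by rewrite -EFinM; congr EFin; field.
have cb' : c + 2 * `|s| <= b by lra.
apply: (le_trans (mollifier_davg mf fK ac d0 cb')).
rewrite lee_pmul2l// -(fineK fin) lee_fin.
by move: dle; rewrite sub0r normrN; exact/le_trans/ler_norm.
Qed.

(** Du Bois-Reymond: testing with a C^1 approximation [phi d] of the indicator of
    the interval from [a] to [b], whose derivative is a difference of two
    mollifiers, and letting the width [d] tend to 0.  The width is written [`|s|] to let the parameter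
    tend to 0 from both sides. *)
Lemma weak_derivative_increment (f g : R -> R) (K a b : R) :
  measurable_fun setT f -> {ae mu, forall x, `|f x| <= K} ->
  measurable_fun setT g -> {ae mu, forall x, `|g x| <= K} ->
  weak_derivative f g -> a < b -> lebesgue_pt f a -> lebesgue_pt f b ->
  f b - f a = \int[mu]_(x in `[a, b]) g x.
Proof.
move=> mf fK mg gK fg ab fa fb.
pose D := `[a, b + 2]%classic : set R.
have mD : measurable D by exact: measurable_itv.
have fD : (mu D < +oo)%E := itv_finite_measure a (b + 2).
pose phi d x := ramp (d^-1 * (x - a)) - ramp (d^-1 * (x - b)).
pose phi' d x := mollifier a d x - mollifier b d x.
have dphi (d x : R) : is_derive x 1 (phi d) (phi' d x).
  by apply: is_deriveB; exact: is_derive_ramp_scaled.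
have phiE (d x : R) : (phi d)^`()%classic x = phi' d x.
  exact: is_derive_derive1 (dphi d x).
have cphi d : continuous (phi d).
  by move=> x; exact: is_derive1_continuous (dphi d x).
have cphi' d : continuous (phi' d).
  by move=> x; apply: cvgB; exact: mollifier_continuous.
have phi_out d x : 0 < d -> d <= 1 -> ~ D x -> phi d x = 0.
  move=> d0 d1 Dx; rewrite /phi.
  have [xa|xa] := leP x a.
    rewrite !ramp_eq0 ?subrr// pmulr_rle0 ?invr_gt0// subr_le0//.
    exact: le_trans xa (ltW ab).
  have bx : b + 2 < x.
    rewrite ltNge; apply/negP => xb; apply: Dx.
    by rewrite /D/= in_itv/= xb ltW.
  by rewrite !ramp_eq1 ?subrr// mulrC ler_pdivlMr//; lra.
have phi'_out d x : 0 < d -> d <= 1 -> ~ D x -> phi' d x = 0.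
  move=> d0 d1 Dx; rewrite /phi'.
  have [xa|xa] := leP x a.
    rewrite !mollifier_out ?subrr//; left=> //.
    exact: le_trans xa (ltW ab).
  have bx : b + 2 < x.
    rewrite ltNge; apply/negP => xb; apply: Dx.
    by rewrite /D/= in_itv/= xb ltW.
  by rewrite !mollifier_out ?subrr//; right; lra.
have test d : 0 < d -> d <= 1 -> test_function (phi d).
  move=> d0 d1; split.
  - by move=> x; have [] := dphi d x.
  - by rewrite (_ : (phi d)^`()%classic = phi' d)//; apply/funext => x.
  - apply: (@subclosed_compact _ _ D); [exact: closed_closure|exact: segment_compact|].
    rewrite closureE; apply: smallest_sub; first exact: itv_closed.
    by move=> x /=; apply: contra_neqP => Dx; exact: phi_out.
have setTD (F G : R -> R) : (forall x, ~ D x -> G x = 0) ->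
    \int[mu]_x (F x * G x) = \int[mu]_(x in D) (F x * G x).
  move=> G0; rewrite [RHS]Rintegral_mkcond; congr fine; congr integral.
  apply/funext => x; rewrite patchE; case: ifPn => // /negP; rewrite inE => Dx.
  by rewrite G0// mulr0.
have eqd d : 0 < d -> d <= 1 ->
  \int[mu]_(x in D) (f x * mollifier a d x)
    - \int[mu]_(x in D) (f x * mollifier b d x)
  = - \int[mu]_(x in D) (g x * phi d x).
  move=> d0 d1.
  have fi c : mu.-integrable D (EFin \o (fun x => f x * mollifier c d x)).
    apply: (@bounded_ae_integrable _ _ mD fD _ (K * d^-1)).
      apply: measurable_funM; first exact: measurable_funTS.
      exact: continuous_measurable (@mollifier_continuous _ c d).
    move: fK; apply: ae_imply => x fx _.
    have /andP[m0 m1] := @mollifier_ge0_le _ c d x d0.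
    by rewrite normrM ler_pM// ger0_norm.
  rewrite -RintegralB// -setTD; last by move=> x; exact: phi_out.
  rewrite -(fg _ (test _ d0 d1)) setTD; last first.
    by move=> x Dx; rewrite phiE phi'_out.
  by apply: eq_Rintegral => x _; rewrite phiE /phi' mulrBr.
have lim1 : \int[mu]_(x in D) (f x * mollifier a `|s| x)
    - \int[mu]_(x in D) (f x * mollifier b `|s| x) @[s --> (0:R)^'] --> f a - f b.
  apply: cvgB; apply: (@mollifier_cvg f a (b + 2) _ K) => //; lra.
have lim2 : (- (\int[mu]_(x in D) (g x * phi `|s| x))) @[s --> (0:R)^'] -->
    - (\int[mu]_(x in D) (g x * \1_(`]a, b]%classic : set R) x)).
  apply: cvgN; apply: (@Rintegral_cvg_dnbhs _ _ mD fD _ _ 0 1 K) => //.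
  - move=> s _ _; apply: measurable_funM; first exact: measurable_funTS.
    exact: continuous_measurable (cphi _).
  - move: gK; apply: ae_imply => x gx _ s _ _.
    rewrite normrM -[leRHS]mulr1 ler_pM// /phi.
    have /andP[? ?] := ramp_ge0_le1 (`|s|^-1 * (x - a)).
    have /andP[? ?] := ramp_ge0_le1 (`|s|^-1 * (x - b)).
    by rewrite ler_norml; apply/andP; split; lra.
  - apply: measurable_funM; first exact: measurable_funTS.
    exact: measurable_indic.
  - apply: aeW => x _; apply: cvg_near_cst.
    have step c : \forall s \near (0:R)^', ramp (`|s|^-1 * (x - c)) = (c < x)%R%:R.
      have [cx|xc] := ltP c x; last first.
        exists 1 => //= s _ s0; rewrite ramp_eq0//.
        by rewrite pmulr_rle0 ?invr_gt0 ?normr_gt0// subr_le0.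
      exists ((x - c) / 2); first by rewrite /= divr_gt0 ?subr_gt0.
      move=> s /=; rewrite sub0r normrN => sx s0; rewrite ramp_eq1//.
      by rewrite mulrC ler_pdivlMr ?normr_gt0//; lra.
    near=> s; congr (_ * _); rewrite /phi.
    have -> : ramp (`|s|^-1 * (x - a)) = (a < x)%R%:R by near: s; exact: step.
    have -> : ramp (`|s|^-1 * (x - b)) = (b < x)%R%:R by near: s; exact: step.
    rewrite indicE /= mem_setE/= in_itv/=.
    have [ax|xa] := ltP a x; have [bx|xb] := ltP b x => //=.
    + by rewrite subrr.
    + by rewrite subr0.
    + by have := lt_trans ab (lt_le_trans bx xa); rewrite ltxx.
    + by rewrite subrr.
have lim12 : (- (\int[mu]_(x in D) (g x * phi `|s| x))) @[s --> (0:R)^'] --> f a - f b.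
  apply: cvg_trans lim1; apply: near_eq_cvg.
  exists 1 => //= s /=; rewrite sub0r normrN => s1 s0; apply: eqd.
    by rewrite normr_gt0.
  exact: ltW.
have -> : f b - f a = - (f a - f b) by rewrite opprB.
rewrite (cvg_unique _ lim12 lim2)// opprK.
transitivity (\int[mu]_(x in D) (g \_ `]a, b]) x).
  apply: eq_Rintegral => x _; rewrite patchE indicE.
  by case: ifP => _; rewrite ?mulr1 ?mulr0.
rewrite -Rintegral_mkcondr.
have -> : (D `&` `]a, b])%classic = `]a, b]%classic.
  apply/seteqP; split=> x; first by case.
  move=> xab; split=> //; move: xab; rewrite /D/= !in_itv/= => /andP[ax xb].
  by rewrite ltW//=; lra.
rewrite Rintegral_itv_obnd_cbnd//.
apply: (@bounded_ae_integrable _ _ _ _ _ K).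
- exact: measurable_itv.
- by rewrite lebesgue_measure_itv/=; case: ifP => _; rewrite ?ltry.
- exact: measurable_funTS.
- by move: gK; apply: ae_imply.
Unshelve. all: by end_near. Qed.

End WeakDerivative.

Section Sobolev.
Context {R : realType}.
Local Notation mu := (@lebesgue_measure R).

Lemma lebesgue_setT_gt0 : (0 < mu setT)%E.
Proof.
apply: (@lt_le_trans _ _ (mu `[0%R, 1%R]%classic)).
  by rewrite lebesgue_measure_itv/= lte_fin ltr01 -EFinD subr0 lte_fin ltr01.
by rewrite le_measure ?inE//=; exact: measurable_itv.
Qed.

Lemma Lfun_oo_bounded (f : R -> R) : f \in Lfun mu +oo%E ->
  measurable_fun setT f /\ exists K, {ae mu, forall x, `|f x| <= K}.
Proof.
rewrite inE/= => /andP[]; rewrite !inE/= => mf; rewrite /finite_norm unlock.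
rewrite lebesgue_setT_gt0 => foo; split => //.
by have [K fK] := @ess_supr_bounded _ _ _ mu (fun x => `|f x|) foo; exists K.
Qed.

Lemma ae_exists_itv (P : R -> Prop) (a b : R) : {ae mu, forall x, P x} ->
  a < b -> exists2 x, a < x < b & P x.
Proof.
move=> aeP ab; apply: contrapT => nP.
have m0 : mu (`]a, b[%classic : set R) = 0%E.
  apply: measure_negligible; first exact: measurable_itv.
  apply: negligibleS aeP => x; rewrite /= in_itv/= => xab Px.
  by apply: nP; exists x.
move/eqP: m0; rewrite lebesgue_measure_itv/= lte_fin ab -EFinD.
by rewrite eqe subr_eq0 gt_eqF.
Qed.

Section Representative.
Variables (h h1 h2 : R -> R) (K : R).
Hypothesis ch : continuous h.
Hypotheses (mh1 : measurable_fun setT h1) (mh2 : measurable_fun setT h2).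
Hypothesis hK : {ae mu, forall x, `|h x| <= K}.
Hypothesis h1K : {ae mu, forall x, `|h1 x| <= K}.
Hypothesis h2K : {ae mu, forall x, `|h2 x| <= K}.
Hypothesis wh : weak_derivative h h1.
Hypothesis wh1 : weak_derivative h1 h2.

Lemma itv_integrable (g : R -> R) (a b : R) : measurable_fun setT g ->
  {ae mu, forall x, `|g x| <= K} -> mu.-integrable `[a, b] (EFin \o g).
Proof.
move=> mg gK; apply: (@bounded_ae_integrable _ _ _ _ _ K).
- exact: measurable_itv.
- exact: itv_finite_measure.
- exact: measurable_funTS.
- by move: gK; apply: ae_imply.
Qed.

Lemma itv_Rintegral_le (g : R -> R) (a b : R) : measurable_fun setT g ->
  {ae mu, forall x, `|g x| <= K} -> a <= b ->
  `|\int[mu]_(x in `[a, b]) g x| <= K * (b - a).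
Proof.
move=> mg gK ab; have gi := itv_integrable a b mg gK.
have cK (c : R) : \int[mu]_(x in `[a, b]) c = c * (b - a).
  rewrite Rintegral_cst//= lebesgue_measure_itv/= lte_fin.
  case: ltP => [//|ba]; have -> : a = b by apply/eqP; rewrite eq_le ab.
  by rewrite subrr.
have ci (c : R) : mu.-integrable `[a, b] (EFin \o cst c).
  apply: (@bounded_ae_integrable _ _ _ _ _ `|c|).
  - exact: measurable_itv.
  - exact: itv_finite_measure.
  - exact: measurable_cst.
  - by apply: aeW => x _.
rewrite ler_norml -mulNr -!cK; apply/andP; split.
  apply: ae_le_Rintegral => //; first exact: ci.
  by move: gK; apply: ae_imply => x; rewrite ler_norml => /andP[].
apply: ae_le_Rintegral => //; first exact: ci.
by move: gK; apply: ae_imply => x; rewrite ler_norml => /andP[].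
Qed.

Lemma itv_RintegralB (g : R -> R) (a x y : R) : measurable_fun setT g ->
  {ae mu, forall x, `|g x| <= K} -> a <= x -> x <= y ->
  \int[mu]_(s in `[a, y]) g s - \int[mu]_(s in `[a, x]) g s =
    \int[mu]_(s in `[x, y]) g s.
Proof.
move=> mg gK ax xy.
rewrite Rintegral_itvB ?bnd_simp//; last exact: itv_integrable.
rewrite Rintegral_itv_obnd_cbnd//.
have /integrableS := itv_integrable x y mg gK; apply => //.
by apply: subset_itvr; rewrite bnd_simp.
Qed.

Lemma increment_weak_derivative (x y : R) : x < y ->
  h y - h x = \int[mu]_(s in `[x, y]) h1 s.
Proof.
have lebh z : lebesgue_pt h z.
  apply: (@continuous_lebesgue_pt _ h z setT) => //.
  - by split => //; exact: openT.
  - exact: continuous_measurable.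
  - exact: ch.
move=> xy; apply: (@weak_derivative_increment _ h h1 K) => //.
exact: continuous_measurable.
Qed.

Lemma weak_lipschitz (x y : R) : `|h x - h y| <= K * `|x - y|.
Proof.
wlog xy : x y / x <= y.
  move=> H; have [xy|/ltW yx] := leP x y; first exact: H.
  by rewrite distrC (distrC x); exact: H.
move: xy; rewrite le_eqVlt => /predU1P[->|xy]; first by rewrite !subrr normr0 mulr0.
rewrite distrC increment_weak_derivative// (distrC x).
rewrite [X in _ * X]ger0_norm ?subr_ge0 ?(ltW xy)//.
by apply: itv_Rintegral_le => //; exact: ltW.
Qed.

Lemma locally_integrable_bounded (g : R -> R) : measurable_fun setT g ->
  {ae mu, forall x, `|g x| <= K} -> locally_integrable setT g.
Proof.
move=> mg gK; split; [exact: mg|exact: openT|].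
move=> C _ cC.
have /integrableP[] // : mu.-integrable C (EFin \o g).
apply: (@bounded_ae_integrable _ _ _ _ _ K).
- exact: compact_measurable.
- exact: compact_finite_measure.
- exact: measurable_funTS.
- by move: gK; apply: ae_imply.
Qed.

(** To the right of [a], the primitive [k] of [h2] agrees with [h1] at the
    Lebesgue points of [h1], hence almost everywhere, so that the increments of
    [h] are integrals of the continuous function [k]. *)
Lemma representative_right (a : R) : exists k : R -> R,
  [/\ forall x y, `|k x - k y| <= K * `|x - y|,
      forall x, a < x -> is_derive x 1 h (k x) &
      {ae mu, forall x, a < x -> is_derive x 1 k (h2 x)}].
Proof.
have leb := lebesgue_differentiation (locally_integrable_bounded mh1 h1K).
have a1 : a < a + 1 by rewrite ltrDl.
have [x0 /andP[ax0 _] leb0] := ae_exists_itv leb a1.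
pose I x := \int[mu]_(s in `[a, x]) h2 s.
pose k x := h1 x0 - I x0 + I x.
have IB x y : a <= x -> x <= y -> I y - I x = \int[mu]_(s in `[x, y]) h2 s.
  exact: itv_RintegralB.
have I0 x : x <= a -> I x = 0.
  rewrite le_eqVlt => /predU1P[->|xa]; first by rewrite /I set_itv1 Rintegral_set1.
  by rewrite /I set_itv_ge ?Rintegral_set0// bnd_simp -ltNge.
have Ile x y : x <= y -> `|I x - I y| <= K * (y - x).
  move=> xy; have K0 : 0 <= K.
    have [z _ /(le_trans (normr_ge0 _))//] := ae_exists_itv hK ltr01.
  have [ya|ay] := leP y a.
    by rewrite !I0 ?subrr ?normr0 ?mulr_ge0 ?subr_ge0// (le_trans xy).
  have [xa|ax] := leP x a; last first.
    by rewrite distrC (IB _ _ (ltW ax) xy); exact: itv_Rintegral_le.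
  rewrite (I0 _ xa) -(I0 a (lexx a)) distrC (IB _ _ (lexx a) (ltW ay)).
  by rewrite (le_trans (itv_Rintegral_le mh2 h2K (ltW ay)))// ler_wpM2l// lerB.
have kL x y : `|k x - k y| <= K * `|x - y|.
  have -> : k x - k y = I x - I y by rewrite /k; ring.
  have [xy|/ltW yx] := leP x y.
    by rewrite (distrC x) (ger0_norm (_ : 0 <= y - x)) ?subr_ge0//; exact: Ile.
  by rewrite distrC (ger0_norm (_ : 0 <= x - y)) ?subr_ge0//; exact: Ile.
have h1k : {ae mu, forall x, a < x -> h1 x = k x}.
  move: leb; apply: ae_imply => x lebx ax; rewrite /k.
  have inc x' y' : a < x' -> x' < y' -> lebesgue_pt h1 x' -> lebesgue_pt h1 y' ->
      h1 y' - h1 x' = I y' - I x'.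
    move=> ax' xy' lx ly; rewrite IB ?ltW//.
    exact: (@weak_derivative_increment _ h1 h2 K).
  have [xx0|xx0|->] := ltgtP x x0.
  - have := inc x x0 ax xx0 lebx leb0; lra.
  - have := inc x0 x ax0 xx0 leb0 lebx; lra.
  - ring.
have ck := lipschitz_continuous kL.
have hk x : a < x -> is_derive x 1 h (k x).
  move=> ax; pose b := (a + x) / 2.
  have ab : a < b by rewrite /b; lra.
  have bx : b < x by rewrite /b; lra.
  have d : is_derive x 1 (fun y => h b + \int[mu]_(s in `[b, y]) k s) (0 + k x).
    by apply: is_deriveD; exact: is_derive_primitive.
  rewrite add0r in d; apply: near_eq_is_derive d.
  exists (x - b); first by rewrite /= subr_gt0.
  move=> y /=; rewrite ltr_norml => /andP[_ xy].
  have by_ : b < y by lra.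
  rewrite -[RHS](subrK (h b)) [RHS]addrC increment_weak_derivative//; congr (_ + _).
  apply: ae_eq_Rintegral.
  - exact: measurable_itv.
  - exact: continuous_measurable.
  - exact: measurable_funTS.
  move: h1k; apply: ae_imply => s hs; rewrite /= in_itv/= => /andP[bs _].
  by rewrite hs// (lt_le_trans ab).
exists k; split => //.
have := @FTC1 R h2 (BLeft a) (fun y => itv_integrable a y mh2 h2K)
  (locally_integrable_bounded mh2 h2K).
apply: ae_imply => x dI ax.
have [dI1 dI2] := dI ltac:(by rewrite /= lte_fin).
rewrite -[h2 x]add0r; apply: is_deriveD; rewrite -dI2.
exact: derivable_is_derive1.
Qed.

Lemma representative :
  [/\ forall x : R, is_derive x 1 h (h^`()%classic x),
      forall x y, `|h^`()%classic x - h^`()%classic y| <= K * `|x - y| &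
      {ae mu, forall x : R, is_derive x 1 h^`()%classic (h2 x)}].
Proof.
have hE (a : R) (k : R -> R) (x : R) : (forall x : R, a < x -> is_derive x 1 h (k x)) -> a < x ->
    h^`()%classic x = k x.
  by move=> hk ax; exact: is_derive_derive1 (hk _ ax).
split.
- move=> x; have [k [_ hk _]] := representative_right (x - 1).
  have x1 : x - 1 < x by rewrite ltrBlDr ltrDl.
  by rewrite (hE _ _ _ hk x1); exact: hk.
- move=> x y; have [k [kL hk _]] := representative_right (Num.min x y - 1).
  have m1 : Num.min x y - 1 < Num.min x y by rewrite ltrBlDr ltrDl.
  by rewrite !(hE _ _ _ hk)//; rewrite (lt_le_trans m1)// ge_min lexx ?orbT.
have : mu.-negligible (\bigcup_n [set x : R | - n%:R < x /\
    ~ is_derive x 1 h^`()%classic (h2 x)]).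
  apply: negligible_bigcup => n.
  have [k [_ hk k2]] := representative_right (- n%:R).
  apply: negligibleS k2 => x /= [nx nd] H; apply: nd.
  apply: near_eq_is_derive (H nx).
  exists (x + n%:R); first by rewrite /=; lra.
  move=> y /=; rewrite ltr_norml => /andP[_ xy].
  by rewrite (hE _ _ _ hk)//; lra.
apply: negligibleS => x /= nd; exists (Num.truncn `|x|).+1 => //; split => //.
by rewrite ltrNl (le_lt_trans (ler_norm _))// normrN truncnS_gt.
Qed.

End Representative.

(** W^{2,oo} functions are the C^{1,1} functions, and the weak second derivative
    is the almost everywhere derivative of the first one. *)
Lemma W2oo_representative (h h2 : R -> R) : W2oo h h2 ->
  exists K, [/\ measurable_fun setT h2,
    forall x y, `|h x - h y| <= K * `|x - y|,
    forall x : R, is_derive x 1 h (h^`()%classic x),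
    forall x y, `|h^`()%classic x - h^`()%classic y| <= K * `|x - y| &
    {ae mu, forall x : R, is_derive x 1 h^`()%classic (h2 x)}].
Proof.
move=> [ch /Lfun_oo_bounded[mh [K0 hK]] /Lfun_oo_bounded[mh2 [K2 h2K]]].
move=> [h1 /Lfun_oo_bounded[mh1 [K1 h1K]] [wh wh1]].
pose K := Num.max K0 (Num.max K1 K2).
have {}hK : {ae mu, forall x, `|h x| <= K}.
  by move: hK; apply: ae_imply => x hx; rewrite /K le_max hx.
have {}h1K : {ae mu, forall x, `|h1 x| <= K}.
  by move: h1K; apply: ae_imply => x hx; rewrite /K !le_max hx orbT.
have {}h2K : {ae mu, forall x, `|h2 x| <= K}.
  by move: h2K; apply: ae_imply => x hx; rewrite /K !le_max hx !orbT.
have [r1 r2 r3] := representative ch mh1 mh2 hK h1K h2K wh wh1.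
exists K; split => //.
exact: (weak_lipschitz ch mh1 hK h1K wh).
Qed.

End Sobolev.

(** * Functions on the space-time strip *)

Section Strip.
Context {R : realType}.
Local Notation mu := (@lebesgue_measure R).
Variable T : R.

Lemma strip_open : open (strip T).
Proof.
rewrite (_ : strip T = snd @^-1` (`]0, T[%classic : set R)); last first.
  by apply/seteqP; split => z /=; rewrite in_itv.
by apply: open_comp; [move=> z _; exact: cvg_snd|exact: interval_open].
Qed.

(** The bounds are uniform up to the times 0 and [T], although the partial
    derivatives are only meaningful inside the strip. *)
Record bounded_C1 (v : R -> R -> R) (M : R) : Prop := {
  bC1_C1 : Ck 1 (strip T) v;
  bC1_periodic : forall t : R, 0 < t < T -> periodic (fun x => v x t) 1;
  bC1_le : forall x t : R, 0 < t < T -> `|v x t| <= M;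
  bC1_d1 : forall x t : R, 0 < t < T -> `|d1 v x t| <= M;
  bC1_d2 : forall x t : R, 0 < t < T -> `|d2 v x t| <= M }.

Section OneFunction.
Variables (v : R -> R -> R) (M : R).
Hypothesis vM : bounded_C1 v M.

Lemma strip_is_derive1 (x t : R) : 0 < t < T -> is_derive x 1 (fun y => v y t) (d1 v x t).
Proof. by move=> tT; exact: (Ck_is_derive1 (bC1_C1 vM)). Qed.

Lemma strip_is_derive2 (x t : R) : 0 < t < T -> is_derive t 1 (v x) (d2 v x t).
Proof. by move=> tT; exact: (Ck_is_derive2 (bC1_C1 vM)). Qed.

Lemma strip_lipschitz1 (t x y : R) : 0 < t < T -> `|v x t - v y t| <= M * `|x - y|.
Proof.
move=> tT; apply: (@derive_bounded_lipschitz _ (fun x => v x t) (fun x => d1 v x t)).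
by move=> z _; split; [exact: strip_is_derive1|exact: (bC1_d1 vM)].
Qed.

Lemma strip_lipschitz2 (x s t : R) : 0 < s < T -> 0 < t < T ->
  `|v x s - v x t| <= M * `|s - t|.
Proof.
wlog st : s t / s <= t => [H sT tT|/andP[s0 _] /andP[_ tT]].
  by have [/H|/ltW/H] := leP s t; [exact|rewrite distrC (distrC s); exact].
have inT z : s <= z <= t -> 0 < z < T.
  by move=> /andP[sz zt]; rewrite (lt_le_trans s0)// (le_lt_trans zt).
rewrite distrC (distrC s); have [||z] := @MVT_segment _ (v x) (d2 v x) s t st.
- move=> z; rewrite in_itv/= => /andP[sz zt]; apply: strip_is_derive2.
  by apply: inT; rewrite !ltW.
- apply: derivable_within_continuous => z; rewrite in_itv/= => /inT zT.
  by have [] := @strip_is_derive2 x z zT.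
rewrite in_itv/= => /inT zT ->; rewrite normrM ler_wpM2r//.
exact: (bC1_d2 vM).
Qed.

End OneFunction.

Lemma strip_continuous1 k v (t : R) : Ck k (strip T) v -> 0 < t < T ->
  continuous (fun x => v x t).
Proof.
move=> vk tT x; have cv := Ck_for_continuous strip_open vk (tT : strip T (x, t)).
apply: (@continuous_comp _ _ _ (fun y => (y, t)) (fun z : R * R => v z.1 z.2)); last exact: cv.
by apply: (@cvg_pair _ _ _ (nbhs x) (nbhs x) (nbhs t)); [exact: cvg_id|exact: cvg_cst].
Qed.

Lemma strip_continuous2 k v (x t : R) : Ck k (strip T) v -> 0 < t < T ->
  {for t, continuous (v x)}.
Proof.
move=> vk tT; have cv := Ck_for_continuous strip_open vk (tT : strip T (x, t)).
apply: (@continuous_comp _ _ _ (fun s => (x, s)) (fun z : R * R => v z.1 z.2)); last exact: cv.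
by apply: (@cvg_pair _ _ _ (nbhs t) (nbhs x) (nbhs t)); [exact: cvg_cst|exact: cvg_id].
Qed.

Lemma strip_near (t : R) : 0 < t < T ->
  exists2 r : R, 0 < r & forall s : R, `|s - t| < r -> 0 < s < T.
Proof.
move=> /andP[t0 tT]; exists (Num.min t (T - t)).
  by rewrite lt_min t0 subr_gt0.
move=> s; rewrite lt_min !ltr_norml => /andP[/andP[s1 _] /andP[_ s2]].
by apply/andP; split; lra.
Qed.

(** For a fixed [x] the trajectory [m x] avoids [N] at almost every time, except
    where it is stationary; Fubini turns this into a statement at almost every
    time about almost every [x].  For the [x]-derivative each time is good. *)
Lemma ae_strip_regular (N : set R) (m : R -> R -> R) : mu.-negligible N ->
  Ck 1 (strip T) m ->
  {ae mu, forall t : R, 0 < t < T ->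
    {ae mu, forall x, (d1 m x t != 0) || (d2 m x t != 0) -> ~ N (m x t)}}.
Proof.
move=> N0 m1; have [N' [mN' N'0 NN']] := N0.
have N'neg : mu.-negligible N' by exists N'; split.
pose A := [set z : R * R | [/\ strip T z, N' (m z.1 z.2) & d2 m z.1 z.2 != 0]].
have mst : measurable (strip T) by apply: open_measurable_prod; exact: strip_open.
have mA : measurable A.
  have -> : A = (strip T `&` ((fun z : R * R => m z.1 z.2) @^-1` N')) `&`
      (strip T `&` ((fun z : R * R => d2 m z.1 z.2) @^-1` [set y : R | y != 0])).
    by apply/seteqP; split => [z [? ? ?]|z [[? ?] [? ?]]].
  apply: measurableI.
    apply: (open_continuous_measurable_prod strip_open m1.1) => //.
  have [_ [_ _ [cm2 _]]] := m1.
  apply: (open_continuous_measurable_prod strip_open cm2) => //.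
  rewrite (_ : [set y : R | y != 0] = ~` [set 0]).
    by apply: measurableC; exact: measurable_set1.
  by apply/seteqP; split => y /= /eqP.
have A0 x : mu (xsection A x) = 0%E.
  apply: measure_negligible; first exact: measurable_xsection.
  apply: negligibleS (negligible_critical_preimage (m x) N'neg) => t.
  rewrite /xsection/= inE => -[/= tT Nm m2].
  by exists (d2 m x t) => //; exact: (Ck_is_derive2 m1).
move: (ae_ysection0 mA A0); apply: ae_imply => t At tT.
have A0' : {ae mu, forall x, ~ ysection A t x}.
  exists (ysection A t); split => //; first exact: measurable_ysection.
  by move=> x /= /contrapT.
have B0 : {ae mu, forall x : R, ~ (exists2 d : R, is_derive x 1 (fun y => m y t) d &
    d != 0 /\ N (m x t))}.
  apply: negligibleS (negligible_critical_preimage (fun y => m y t) N0).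
  by move=> x /= /contrapT.
move: (ae_and A0' B0); apply: ae_imply => x [Ax Bx] /orP[mx|mt] Nm.
  by apply: Bx; exists (d1 m x t) => //; exact: (Ck_is_derive1 m1).
by apply: Ax; rewrite /ysection/= inE; split => //=; exact: NN'.
Qed.

End Strip.

(** * Evolution of an internal energy *)

Section Evolution.
Context {R : realType}.
Local Notation mu := (@lebesgue_measure R).
Variables (T M K : R) (m w : R -> R -> R) (h h2 : R -> R).
Hypotheses (mM : bounded_C1 T m M) (wM : bounded_C1 T w M).
Hypothesis m_evol : forall x t : R, 0 < t < T ->
  d2 m x t = d1 m x t * w x t + m x t * d1 w x t.
Local Notation h' := (h^`()%classic).
Hypothesis mh2 : measurable_fun setT h2.
Hypothesis hL : forall x y, `|h x - h y| <= K * `|x - y|.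
Hypothesis dh : forall x : R, is_derive x 1 h (h' x).
Hypothesis h'L : forall x y, `|h' x - h' y| <= K * `|x - y|.
Hypothesis dh' : {ae mu, forall x : R, is_derive x 1 h' (h2 x)}.

(** The thermodynamic pressure of the internal energy density [h]; formally its
    derivative is [s * h2 s]. *)
Definition pressure (s : R) := s * h' s - h s.
Definition energy (t : R) := \int[mu]_(x in `[0, 1]) h (m x t).
(** The derivative of [energy], in the form that can be differentiated once more. *)
Definition energy_rate (t : R) := \int[mu]_(x in `[0, 1]) (pressure (m x t) * d1 w x t).

Let h'K x : `|h' x| <= K.
Proof. exact: (lipschitz_derive_le (fun y => hL y x) (dh x)). Qed.

Let K0 : 0 <= K.
Proof. exact: le_trans (normr_ge0 _) (h'K 0). Qed.

(** Both chain rules for [h' (m x t)] hold at almost every [x]: where the two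
    partial derivatives of [m] vanish nothing is asked, since the Lipschitz bound
    on [h'] takes over. *)
Definition regular (t : R) := {ae mu, forall x, (d1 m x t != 0) || (d2 m x t != 0) ->
  is_derive (m x t) 1 h' (h2 (m x t))}.

Definition space_regular (t : R) := {ae mu, forall x, d1 m x t != 0 ->
  is_derive (m x t) 1 h' (h2 (m x t))}.

Lemma ae_regular : {ae mu, forall t : R, 0 < t < T -> regular t}.
Proof.
have N0 : mu.-negligible [set s : R | ~ is_derive s 1 h' (h2 s)] := dh'.
move: (ae_strip_regular N0 (bC1_C1 mM)).
apply: ae_imply => t + tT => /(_ tT); apply: ae_imply => x H /H.
exact: contrapT.
Qed.

Lemma space_regularT (t : R) : 0 < t < T -> space_regular t.
Proof.
move=> tT; have N0 : mu.-negligible [set s : R | ~ is_derive s 1 h' (h2 s)] := dh'.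
apply: negligibleS (negligible_critical_preimage (fun y => m y t) N0) => x /=.
move=> /not_implyP[mx nd]; exists (d1 m x t) => //.
exact: strip_is_derive1 mM _ _ tT.
Qed.

Let is_derive_pressure (s : R) : is_derive s 1 h' (h2 s) -> is_derive s 1 pressure (s * h2 s).
Proof.
move=> ds; have -> : s * h2 s = (1 * h' s + s * h2 s) - h' s by ring.
by apply: is_deriveB; apply: is_derive1M.
Qed.

Let pressure_lipschitz (a b : R) : `|a| <= M -> `|b| <= M ->
  `|pressure a - pressure b| <= (M * K + 2 * K) * `|a - b|.
Proof.
move=> aM bM; have -> : pressure a - pressure b =
    a * (h' a - h' b) + (a - b) * h' b - (h a - h b) by rewrite /pressure; ring.
rewrite (le_trans (ler_normB _ _))//.
apply: (@le_trans _ _ ((M * (K * `|a - b|) + `|a - b| * K) + K * `|a - b|)).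
  rewrite lerD// (le_trans (ler_normD _ _))// !normrM lerD//.
    by apply: ler_pM.
  by apply: ler_wpM2l.
by rewrite le_eqVlt; apply/orP; left; apply/eqP; ring.
Qed.

Let pressure_cst := M * K + 2 * K.

Let pressure_bounded : exists B : R, forall a : R, `|a| <= M -> `|pressure a| <= B.
Proof.
exists (`|pressure 0| + pressure_cst * `|M|) => a aM.
rewrite -[pressure a](subrK (pressure 0)) addrC (le_trans (ler_normD _ _))// lerD2l.
have M0 : 0 <= M by exact: le_trans aM.
rewrite (le_trans (pressure_lipschitz aM _)) ?normr0// subr0 ler_wpM2l//.
  by rewrite /pressure_cst addr_ge0// mulr_ge0.
by rewrite (le_trans aM)// ler_norm.
Qed.

Let M0 : 0 < T -> 0 <= M.
Proof.
move=> T0; apply: le_trans (normr_ge0 _) (@bC1_le _ _ _ _ mM 0 (T / 2) _).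
by apply/andP; split; lra.
Qed.

Let cmx (t : R) : 0 < t < T -> continuous (fun x => m x t).
Proof. exact: strip_continuous1 (bC1_C1 mM). Qed.
Let cwx (t : R) : 0 < t < T -> continuous (fun x => w x t).
Proof. exact: strip_continuous1 (bC1_C1 wM). Qed.
Let cm1 (t : R) : 0 < t < T -> continuous (fun x => d1 m x t).
Proof. exact: strip_continuous1 (Ck_d1 (bC1_C1 mM)). Qed.
Let cm2 (t : R) : 0 < t < T -> continuous (fun x => d2 m x t).
Proof. exact: strip_continuous1 (Ck_d2 (bC1_C1 mM)). Qed.
Let cw1 (t : R) : 0 < t < T -> continuous (fun x => d1 w x t).
Proof. exact: strip_continuous1 (Ck_d1 (bC1_C1 wM)). Qed.
Let cw2 (t : R) : 0 < t < T -> continuous (fun x => d2 w x t).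
Proof. exact: strip_continuous1 (Ck_d2 (bC1_C1 wM)). Qed.

Let ch : continuous h.
Proof. exact: lipschitz_continuous hL. Qed.
Let ch' : continuous h'.
Proof. exact: lipschitz_continuous h'L. Qed.
Let continuous_pressure : continuous pressure.
Proof.
move=> s; apply: cvgB; last exact: ch.
by apply: cvgM; [exact: cvg_id|exact: ch'].
Qed.

Let cont_comp (f : R -> R) (t : R) : continuous f -> 0 < t < T ->
  continuous (fun x => f (m x t)).
Proof.
move=> cf tT x; apply: (@continuous_comp _ _ _ (fun x => m x t) f).
  exact: cmx.
exact: cf.
Qed.

Let mea := @continuous_measurable R.
Let I01 : set R := `[0, 1]%classic.
Let mI : measurable I01. Proof. exact: measurable_itv. Qed.
Let fI : (mu I01 < +oo)%E. Proof. exact: itv_finite_measure. Qed.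

Let per (v : R -> R -> R) (B t : R) : bounded_C1 T v B -> 0 < t < T -> v 1 t = v 0 t.
Proof. by move=> vB tT; have := bC1_periodic vB tT 0; rewrite add0r. Qed.

Lemma is_derive_energy_h' t : 0 < t < T ->
  is_derive t 1 energy (\int[mu]_(x in `[0, 1]) (h' (m x t) * d2 m x t)).
Proof.
move=> tT; have [r r0 Hr] := strip_near tT.
have T0 : 0 < T by move/andP: tT => [/lt_trans]; apply.
apply: (@is_derive_Rintegral _ _ mI fI (fun s x => h (m x s)) _ t r
  (`|h 0| + K * M) (K * M)) => //.
- by move=> s /Hr sT; apply: mea; exact: cont_comp.
- move=> s x /Hr sT _; rewrite -[h _](subrK (h 0)) addrC.
  rewrite (le_trans (ler_normD _ _))// lerD2l (le_trans (hL _ _))//.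
  by rewrite subr0 ler_wpM2l// (bC1_le mM).
- move=> s x /Hr sT _; rewrite (le_trans (hL _ _))// -mulrA ler_wpM2l//.
  exact: strip_lipschitz2 mM _ _ _ sT tT.
- apply: mea => x; apply: cvgM; last exact: cm2.
  exact: (cont_comp ch' tT).
- apply: aeW => x _; apply: (@is_derive1_comp _ h (m x)) => //.
  exact: strip_is_derive2 mM _ _ tT.
Qed.

(** By [m_evol] the two integrands differ by the total derivative of the periodic
    function [h (m x t) * w x t]. *)
Lemma energy_rate_pressure t : 0 < t < T ->
  \int[mu]_(x in `[0, 1]) (h' (m x t) * d2 m x t) = energy_rate t.
Proof.
move=> tT; apply/eqP; rewrite -subr_eq0.
have c1 : continuous (fun x => h' (m x t) * d2 m x t).
  by move=> x; apply: cvgM; [exact: (cont_comp ch' tT)|exact: cm2].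
have c2 : continuous (fun x => pressure (m x t) * d1 w x t).
  by move=> x; apply: cvgM; [exact: (cont_comp continuous_pressure tT)|exact: cw1].
have int (f : R -> R) : continuous f -> mu.-integrable `[0, 1] (EFin \o f).
  move=> cf; apply: continuous_compact_integrable; first exact: segment_compact.
  by apply: continuous_subspaceT => ?; exact: cf.
rewrite /energy_rate -RintegralB//; [|exact: int|exact: int].
apply/eqP; transitivity (h (m 1 t) * w 1 t - h (m 0 t) * w 0 t); last first.
  by rewrite (per mM tT) (per wM tT) subrr.
apply: (@Rintegral_FTC2 _ _ (fun x => h (m x t) * w x t)) => //.
  by move=> x; apply: cvgB; [exact: c1|exact: c2].
move=> x _; have -> : h' (m x t) * d2 m x t - pressure (m x t) * d1 w x t =
    (h' (m x t) * d1 m x t) * w x t + h (m x t) * d1 w x t.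
  by rewrite m_evol// /pressure; ring.
apply: is_derive1M; last exact: strip_is_derive1 wM _ _ tT.
apply: (@is_derive1_comp _ h (fun x => m x t)) => //.
exact: strip_is_derive1 mM _ _ tT.
Qed.

Lemma is_derive_energy (t : R) : 0 < t < T -> is_derive t 1 energy (energy_rate t).
Proof. by move=> tT; rewrite -energy_rate_pressure//; exact: is_derive_energy_h'. Qed.

Let h2_bound (s : R) : is_derive s 1 h' (h2 s) -> `|h2 s| <= K.
Proof. exact: (lipschitz_derive_le (fun y => h'L y s)). Qed.

(** [h2] need not be bounded on the null set where it is not the derivative of
    [h'], but there [m] is stationary. *)
Let h2_m_d1_bound (t : R) : 0 < t < T ->
  {ae mu, forall x, `|m x t * h2 (m x t) * d1 m x t| <= M * K * M}.
Proof.
move=> tT; have T0 : 0 < T by move/andP: tT => [/lt_trans]; apply.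
move: (space_regularT tT); apply: ae_imply => x Hx.
have [->|/Hx/h2_bound h2K] := eqVneq (d1 m x t) 0.
  by rewrite mulr0 normr0 !mulr_ge0// M0.
rewrite !normrM ler_pM ?mulr_ge0//; last exact: (bC1_d1 mM).
by apply: ler_pM => //; exact: (bC1_le mM).
Qed.

Let mea_h2 (t : R) : 0 < t < T -> measurable_fun setT (fun x => h2 (m x t)).
Proof.
move=> tT; apply: measurableT_comp => //; apply: mea; exact: cmx.
Qed.

Let mea_mh2m (t : R) : 0 < t < T ->
  measurable_fun setT (fun x => m x t * h2 (m x t) * d1 m x t).
Proof.
move=> tT; apply: measurable_funM; last by apply: mea; exact: cm1.
by apply: measurable_funM; [apply: mea; exact: cmx|exact: mea_h2].
Qed.

(** The integrand of [energy_rate s - energy_rate t] after integration by parts. *)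
Definition rate_increment (t s x : R) := (pressure (m x s) - pressure (m x t)) * d1 w x s
  - m x t * h2 (m x t) * d1 m x t * (w x s - w x t).

Let measurable_rate_increment (t s : R) : 0 < t < T -> 0 < s < T ->
  measurable_fun setT (rate_increment t s).
Proof.
move=> tT sT; apply: measurable_funB; apply: measurable_funM.
- by apply: measurable_funB; apply: mea; exact: cont_comp.
- by apply: mea; exact: cw1.
- exact: mea_mh2m.
- by apply: measurable_funB; apply: mea; exact: cwx.
Qed.

Let rate_cst := pressure_cst * M * M + M * K * M * M.

Let rate_increment_bound (t : R) : 0 < t < T ->
  {ae mu, forall x, forall s : R, 0 < s < T ->
  `|rate_increment t s x| <= rate_cst * `|s - t|}.
Proof.
move=> tT; have T0 : 0 < T by move/andP: tT => [/lt_trans]; apply.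
have M0' := M0 T0.
have pressure_cst0 : 0 <= pressure_cst by rewrite /pressure_cst addr_ge0// mulr_ge0.
move: (h2_m_d1_bound tT); apply: ae_imply => x mx s sT.
rewrite /rate_increment /rate_cst [leRHS]mulrDl (le_trans (ler_normB _ _))// lerD//.
  rewrite normrM mulrAC ler_pM//; last exact: (bC1_d1 wM).
  rewrite (le_trans (pressure_lipschitz _ _)) ?(bC1_le mM)// -mulrA ler_wpM2l//.
  exact: strip_lipschitz2 mM _ _ _ sT tT.
rewrite normrM -[leRHS]mulrA ler_pM//.
exact: strip_lipschitz2 wM _ _ _ sT tT.
Qed.

(** Writing the increment of a product as [(P2 - P1) w2_x + P1 (w2 - w1)_x]
    moves the whole derivative in the second term onto [P1], taken at the base
    time [t]; integration by parts then leaves the factor [h2 (m x t)] frozen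
    while [s] tends to [t], where no continuity of [h2] is available. *)
Lemma energy_rate_increment (t s : R) : 0 < t < T -> 0 < s < T ->
  energy_rate s - energy_rate t = \int[mu]_(x in `[0, 1]) rate_increment t s x.
Proof.
move=> tT sT; have T0 : 0 < T by move/andP: tT => [/lt_trans]; apply.
have [B GB] := pressure_bounded.
pose g x := m x t * h2 (m x t) * d1 m x t * (w x s - w x t)
  + pressure (m x t) * (d1 w x s - d1 w x t).
have mg : measurable_fun setT g.
  apply: measurable_funD; apply: measurable_funM.
  - exact: mea_mh2m.
  - by apply: measurable_funB; apply: mea; exact: cwx.
  - by apply: mea; exact: cont_comp.
  - by apply: measurable_funB; apply: mea; exact: cw1.
have ibp : \int[mu]_(x in `[0, 1]) g x = 0.
  rewrite (@FTC_lipschitz _ (fun x => pressure (m x t) * (w x s - w x t)) g 0 1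
    (B * (M + M) + pressure_cst * M * (M + M))) => //.
  - by rewrite (per mM tT) (per wM tT) (per wM sT) subrr.
  - apply: lipschitzM.
    + by move=> x; apply: GB; exact: (bC1_le mM).
    + by move=> x; rewrite (le_trans (ler_normB _ _))// lerD// (bC1_le wM).
    + move=> x y; rewrite (le_trans (pressure_lipschitz _ _)) ?(bC1_le mM)// -mulrA ler_wpM2l//.
        by rewrite addr_ge0 ?mulr_ge0 ?M0.
      exact: strip_lipschitz1 mM _ _ _ tT.
    + move=> x y; have -> : w x s - w x t - (w y s - w y t) =
        (w x s - w y s) - (w x t - w y t) by ring.
      rewrite (le_trans (ler_normB _ _))// mulrDl lerD//.
        exact: strip_lipschitz1 wM _ _ _ sT.
      exact: strip_lipschitz1 wM _ _ _ tT.
  - exact: measurable_funTS.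
  move: (space_regularT tT); apply: ae_imply => x Hx _.
  apply: is_derive1M; last first.
    apply: is_deriveB; first exact: strip_is_derive1 wM _ _ sT.
    exact: strip_is_derive1 wM _ _ tT.
  apply: (@is_derive_lipschitz_comp _ pressure (fun x => m x t) x (d1 m x t)
    _ pressure_cst).
  - exists 1; first exact: ltr01.
    by move=> y _; apply: pressure_lipschitz; exact: (bC1_le mM).
  - exact: strip_is_derive1 mM _ _ tT.
  - by move=> /Hx/is_derive_pressure.
have bnd (u : R) : 0 < u < T ->
    mu.-integrable `[0, 1] (EFin \o (fun x => pressure (m x u) * d1 w x u)).
  move=> uT; apply: continuous_compact_integrable; first exact: segment_compact.
  apply: continuous_subspaceT => x.
  by apply: cvgM; [exact: (cont_comp continuous_pressure uT)|exact: cw1].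
have ii : mu.-integrable `[0, 1] (EFin \o rate_increment t s).
  apply: (@itv_integrable _ (rate_cst * `|s - t|)); first exact: measurable_rate_increment.
  by move: (rate_increment_bound tT); apply: ae_imply => x; exact.
have ig : mu.-integrable `[0, 1] (EFin \o g).
  apply: (@itv_integrable _ (M * K * M * (M + M) + B * (M + M))) => //.
  move: (h2_m_d1_bound tT); apply: ae_imply => x mx.
  rewrite /g (le_trans (ler_normD _ _))// lerD// normrM ler_pM//.
  - by rewrite (le_trans (ler_normB _ _))// lerD// (bC1_le wM).
  - by apply: GB; exact: (bC1_le mM).
  - by rewrite (le_trans (ler_normB _ _))// lerD// (bC1_d1 wM).
rewrite /energy_rate -RintegralB//; [|exact: bnd|exact: bnd].
transitivity (\int[mu]_(x in `[0, 1]) rate_increment t s x + \int[mu]_(x in `[0, 1]) g x);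
  last by rewrite ibp addr0.
rewrite -RintegralD//.
by apply: eq_Rintegral => x _; rewrite /rate_increment /g; ring.
Qed.

Lemma energy_rate_lipschitz : exists C : R, forall s t : R,
  0 < s < T -> 0 < t < T -> `|energy_rate s - energy_rate t| <= C * `|s - t|.
Proof.
exists rate_cst => s t sT tT; rewrite energy_rate_increment//.
rewrite -[leRHS]mulr1 -[X in _ * X](subr0 1).
apply: itv_Rintegral_le => //; first exact: measurable_rate_increment.
by move: (rate_increment_bound tT); apply: ae_imply => x; exact.
Qed.

(** The weight [h2 (m x t)] is bounded except at stationary points of [m], where
    [c] vanishes. *)
Lemma regular_integrable (t : R) (c : R -> R) : 0 < t < T -> regular t ->
  continuous c -> (forall x, d1 m x t = 0 -> d2 m x t = 0 -> c x = 0) ->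
  mu.-integrable `[0, 1] (EFin \o (fun x => h2 (m x t) * c x)).
Proof.
move=> tT reg cc c0.
have [B cB] := continuous_bounded_itv 0 1 cc.
apply: (bounded_ae_integrable mI fI (M := K * B)).
  apply: measurable_funTS; apply: measurable_funM; first exact: mea_h2.
  exact: mea.
move: reg; apply: ae_imply => x Hx Ix.
have B0 : 0 <= B by exact: le_trans (cB x Ix).
have [/Hx/h2_bound h2K|] := boolP ((d1 m x t != 0) || (d2 m x t != 0)).
  by rewrite normrM ler_pM// cB.
rewrite negb_or !negbK => /andP[/eqP mx /eqP mt].
by rewrite c0// mulr0 normr0 mulr_ge0.
Qed.

(** Dominated convergence in [rate_increment t s x / (s - t)]: the only factor
    that could fail to converge is the difference quotient of the pressure, and
    it converges at almost every [x] because [t] is regular. *)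
Lemma is_derive_energy_rate (t : R) : 0 < t < T -> regular t ->
  is_derive t 1 energy_rate (\int[mu]_(x in `[0, 1])
    (m x t * h2 (m x t) * (d2 m x t * d1 w x t - d1 m x t * d2 w x t))).
Proof.
move=> tT reg; apply/is_derive_quotientP.
have [r r0 Hr] := strip_near tT.
have T0 : 0 < T by move/andP: tT => [/lt_trans]; apply.
have qE : \forall s \near t^',
    \int[mu]_(x in `[0, 1]) ((s - t)^-1 * rate_increment t s x) =
    (s - t)^-1 * (energy_rate s - energy_rate t).
  exists r => // s /=; rewrite distrC => /Hr sT st.
  rewrite energy_rate_increment// RintegralZl//.
  apply: (@itv_integrable _ (rate_cst * `|s - t|)); first exact: measurable_rate_increment.
  by move: (rate_increment_bound tT); apply: ae_imply => x; exact.
apply: (cvg_trans (@near_eq_cvg _ _ (t^') _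
  (fun s => \int[mu]_(x in `[0, 1]) ((s - t)^-1 * rate_increment t s x)) _ qE)).
apply: (@Rintegral_cvg_dnbhs _ _ mI fI _ _ t r rate_cst) => //.
- move=> s /Hr sT st; apply: measurable_funTS.
  by apply: measurable_funM => //; exact: measurable_rate_increment.
- move: (rate_increment_bound tT); apply: ae_imply => x Hx _ s /Hr sT st.
  rewrite normrM normfV mulrC ler_pdivrMr ?normr_gt0 ?subr_eq0//.
  exact: Hx.
- apply: measurable_funTS; apply: measurable_funM.
    by apply: measurable_funM; [apply: mea; exact: cmx|exact: mea_h2].
  apply: mea => x; apply: cvgB; apply: cvgM.
  - exact: cm2. - exact: cw1. - exact: cm1. - exact: cw2.
move: reg; apply: ae_imply => x reg _.
have -> : m x t * h2 (m x t) * (d2 m x t * d1 w x t - d1 m x t * d2 w x t) =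
  (m x t * h2 (m x t) * d2 m x t) * d1 w x t
  - m x t * h2 (m x t) * d1 m x t * d2 w x t.
  move: (m x t) (h2 _) (d2 m x t) (d1 w x t) (d1 m x t) (d2 w x t) => *; ring.
rewrite (_ : (fun s => _) = (fun s =>
    ((s - t)^-1 * (pressure (m x s) - pressure (m x t))) * d1 w x s
    - m x t * h2 (m x t) * d1 m x t * ((s - t)^-1 * (w x s - w x t)))); last first.
  apply/funext => s; rewrite /rate_increment.
  move: (m x t * h2 (m x t) * d1 m x t) (pressure _ - _) (w x s - _) (d1 w x s) (_^-1).
  by move=> *; ring.
apply: cvgB; apply: cvgM.
- apply/(is_derive_quotientP (fun s => pressure (m x s))).
  apply: (@is_derive_lipschitz_comp _ pressure (m x) t (d2 m x t) _ pressure_cst).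
  + exists r => // s /=; rewrite distrC => /Hr sT.
    by apply: pressure_lipschitz; exact: (bC1_le mM).
  + exact: strip_is_derive2 mM _ _ tT.
  + by move=> mt; apply: is_derive_pressure; apply: reg; rewrite mt orbT.
- apply: cvg_within_filter; exact: (strip_continuous2 (Ck_d1 (bC1_C1 wM)) tT).
- exact: cvg_cst.
- apply/(is_derive_quotientP (w x)).
  exact: strip_is_derive2 wM _ _ tT.
Qed.

End Evolution.

(** * Extension, periodicity and bounds *)

Section ContinuousOn.
Context {R : realType}.
Implicit Types (f g a b : R -> R -> R) (U V : set (R * R)).

Definition continuous2_on U f := forall x y, U (x, y) ->
  {for (x, y), continuous (fun z : R * R => f z.1 z.2)}.

Lemma Ck0P U f : open U -> Ck 0 U f <-> continuous2_on U f.
Proof.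
move=> oU; split=> [[cf _] x y Uxy|cf].
  by move: cf; rewrite (continuous_open_subspace _ oU); apply; exact/mem_set.
split=> //; rewrite (continuous_open_subspace _ oU) => -[x y] /set_mem.
exact: cf.
Qed.

Lemma continuous2_on_eq U f g : open U -> (forall x y, U (x, y) -> f x y = g x y) ->
  continuous2_on U f -> continuous2_on U g.
Proof.
move=> oU fg cf x y Uxy; rewrite /prop_for /continuous_at/= -fg//.
apply: cvg_trans (cf x y Uxy); apply: near_eq_cvg.
have : nbhs (x, y) U by exact: open_nbhs_nbhs.
by apply: filterS => -[x' y'] /= /fg.
Qed.

Lemma continuous2_onD U f g : continuous2_on U f -> continuous2_on U g ->
  continuous2_on U (fun x y => f x y + g x y).
Proof. by move=> cf cg x y Uxy; apply: cvgD; [exact: cf|exact: cg]. Qed.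

Lemma continuous2_onM U f g : continuous2_on U f -> continuous2_on U g ->
  continuous2_on U (fun x y => f x y * g x y).
Proof. by move=> cf cg x y Uxy; apply: cvgM; [exact: cf|exact: cg]. Qed.

Lemma continuous2_on_comp U V f a b : continuous2_on V f ->
  (forall x y, U (x, y) -> V (a x y, b x y)) ->
  continuous2_on U a -> continuous2_on U b ->
  continuous2_on U (fun x y => f (a x y) (b x y)).
Proof.
move=> cf UV ca cb x y Uxy.
apply: (@continuous_comp _ _ _ (fun z : R * R => (a z.1 z.2, b z.1 z.2))
  (fun z : R * R => f z.1 z.2)); last exact: (cf _ _ (UV _ _ Uxy)).
apply: (@cvg_pair _ _ _ (nbhs (x, y)) (nbhs (a x y)) (nbhs (b x y))).
  exact: ca. exact: cb.
Qed.

Lemma Ck1_intro U f f1 f2 : open U ->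
  (forall x y : R, U (x, y) -> is_derive x 1 (f ^~ y) (f1 x y)) ->
  (forall x y : R, U (x, y) -> is_derive y 1 (f x) (f2 x y)) ->
  continuous2_on U f -> continuous2_on U f1 -> continuous2_on U f2 -> Ck 1 U f.
Proof.
move=> oU d1f d2f cf cf1 cf2; split; first exact: ((Ck0P f oU).2 cf).1.
split.
- by move=> x y Uxy; split; [have [] := d1f _ _ Uxy|have [] := d2f _ _ Uxy].
- apply/(Ck0P _ oU); apply: continuous2_on_eq cf1 => // x y Uxy.
  by rewrite /d1 (is_derive_derive1 (d1f _ _ Uxy)).
- apply/(Ck0P _ oU); apply: continuous2_on_eq cf2 => // x y Uxy.
  by rewrite /d2 (is_derive_derive1 (d2f _ _ Uxy)).
Qed.

Lemma Ck_extends_Ck k U f : open U -> Ck_extends k U f -> Ck k U f.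
Proof.
move=> oU; elim: k f => [|k IH] f [[g cg gf] fk].
all: have cf : {within U, continuous (fun z => f z.1 z.2)}.
1, 3: apply: subspace_eq_continuous (continuous_subspaceW (@subset_closure _ U) cg).
1, 2: by move=> z /set_mem Uz; rewrite /from_subspace gf.
by split.
case: fk => pf f1 f2; split; first exact: cf.
by split; [exact: pf|exact: IH f1|exact: IH f2].
Qed.

Lemma Ck_weaken k l U f : (l <= k)%N -> Ck k U f -> Ck l U f.
Proof.
elim: k => [|k IH]; first by rewrite leqn0 => /eqP ->.
by rewrite leq_eqVlt => /predU1P[->//|/IH + /Ck_pred]; exact.
Qed.

End ContinuousOn.

Section Box.
Context {R : realType}.
Variable (T : R) (T0 : 0 < T).

Definition box : set (R * R) := `[0, 1]%classic `*` `[0, T]%classic.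

Lemma box_compact : compact box.
Proof. by apply: compact_setX; exact: segment_compact. Qed.

(** Moving a point of the box slightly towards the time [T / 2] brings it into
    the open strip. *)
Lemma box_closure_strip : box `<=` closure (strip T).
Proof.
move=> [x t] [/= _]; rewrite in_itv/= => /andP[t0 tT].
move=> B /nbhs_ballP[e /= e0 B_e].
pose d := Num.min 1 (e / T / 2).
have d0 : 0 < d by rewrite lt_min ltr01/= !divr_gt0.
have d1 : d <= 1 by rewrite ge_min lexx.
have dT : d * T < e.
  rewrite -ltr_pdivlMr// (@le_lt_trans _ _ (e / T / 2))//; first by rewrite ge_min lexx orbT.
  by rewrite ltr_pdivrMr// ltr_pMr ?divr_gt0// ltr1n.
exists (x, t + d * (T / 2 - t)); split.
  rewrite /strip/=; have dt : d * t <= t by rewrite ler_piMl.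
  have dT' : 0 < d * T by rewrite mulr_gt0.
  have dTt : d * (T - t) <= T - t by rewrite ler_piMl// subr_ge0.
  by apply/andP; split; lra.
apply: B_e; split; first exact: ballxx.
rewrite /ball/= opprD addrA subrr sub0r normrN normrM (gtr0_norm d0).
apply: le_lt_trans dT; rewrite ler_wpM2l ?(ltW d0)// ler_norml.
by apply/andP; split; lra.
Qed.

Definition strip_periodic (v : R -> R -> R) :=
  forall t, 0 < t < T -> periodic (fun x => v x t) 1.

(** A property stable under unit translations needs to be checked on one period
    only. *)
Lemma strip_reduce (P : R -> R -> Prop) (x t : R) : 0 < t < T ->
  (forall y, P y t -> P (y + 1) t) -> (forall y, P y t -> P (y - 1) t) ->
  (forall y, 0 <= y <= 1 -> P y t) -> P x t.
Proof.
move=> tT up dn base.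
have upn n y : P y t -> P (y + n%:R) t.
  elim: n y => [|n IH] y Py; first by rewrite addr0.
  by rewrite -natr1 addrA; apply: up; exact: IH.
have dnn n y : P y t -> P (y - n%:R) t.
  elim: n y => [|n IH] y Py; first by rewrite subr0.
  by rewrite -natr1 opprD addrA; apply: dn; exact: IH.
have fl := floor_itv x.
have b : P (x - (Num.floor x)%:~R) t.
  apply: base; move: fl; rewrite intrD => /andP[? ?].
  by apply/andP; split; [rewrite subr_ge0|rewrite lerBlDr addrC ltW].
case: (Num.floor x) b => n.
  by move=> /(upn n); rewrite subrK.
rewrite NegzE mulrNz opprK => /(dnn n.+1).
by rewrite addrK.
Qed.

Lemma strip_periodic_bounded (v : R -> R -> R) : strip_periodic v ->
  Ck_extends 0 (strip T) v -> exists M, forall x t, 0 < t < T -> `|v x t| <= M.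
Proof.
move=> pv [[g cg gv] _].
have cb : {within box, continuous (fun z => `|g z|)}.
  apply: (continuous_subspaceW box_closure_strip) => z.
  by apply: continuous_comp; [exact: cg|exact: norm_continuous].
have b0 : box !=set0.
  by exists (0, 0); split; rewrite /= in_itv/= ?lexx ?ler01// ltW.
have [c _ gc] := compact_EVT_max b0 box_compact cb.
exists `|g c| => x t tT.
apply: (@strip_reduce (fun x t => `|v x t| <= `|g c|)) => //.
- by move=> y; rewrite (pv _ tT).
- by move=> y; rewrite -{1}(subrK 1 y) (pv _ tT).
move=> y y01; rewrite -(gv (y, t))//; apply: gc; apply/mem_set; split.
  by rewrite /= in_itv.
by move/andP: tT => [t0 tT]; rewrite /= in_itv/= !ltW.
Qed.

Lemma strip_periodic_d1 v : strip_periodic v -> strip_periodic (d1 v).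
Proof.
move=> pv t tT x; rewrite /d1 /derive1.
suff -> : (fun h => h^-1 *: (v (h + (x + 1)) t - v (x + 1) t)) =
    (fun h => h^-1 *: (v (h + x) t - v x t)) by [].
by apply/funext => s; rewrite addrA !(pv _ tT).
Qed.

Lemma strip_periodic_d2 v : strip_periodic v -> strip_periodic (d2 v).
Proof.
move=> pv t tT x; rewrite /d2 !derive1E; apply: near_eq_derive.
have [r r0 Hr] := strip_near tT.
by exists r => // s /=; rewrite distrC => /Hr sT; exact: pv.
Qed.

Lemma strip_periodic_lower_bound (v : R -> R -> R) :
  (forall t, 0 <= t <= T -> periodic (fun x => v x t) 1) ->
  {within closure (strip T), continuous (fun z => v z.1 z.2)} ->
  (forall x t, 0 <= t <= T -> 0 < v x t) ->
  exists2 a, 0 < a & forall x t, 0 < t < T -> a <= v x t.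
Proof.
move=> pv cv v0.
have b0 : box !=set0.
  by exists (0, 0); split; rewrite /= in_itv/= ?lexx ?ler01// ltW.
have [[x0 t0] /set_mem[_ /=]] := compact_EVT_min b0 box_compact
  (continuous_subspaceW box_closure_strip cv).
rewrite in_itv/= => t0T vmin.
exists (v x0 t0); first exact: v0.
move=> x t tT; have tT' : 0 <= t <= T by case/andP: tT => ? ?; rewrite !ltW.
apply: (@strip_reduce (fun x t => v x0 t0 <= v x t)) => //.
- by move=> y; rewrite (pv _ tT').
- by move=> y; rewrite -{1}(subrK 1 y) (pv _ tT').
move=> y y01; apply: (vmin (y, t)); apply/mem_set; split; rewrite /= in_itv//.
Qed.

End Box.

Section Rectangle.
Context {R : realType}.

Lemma halfplane_open : open (@halfplane R).
Proof.
rewrite (_ : halfplane = snd @^-1` (`]0, +oo[%classic : set R)); last first.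
  by apply/seteqP; split => z; rewrite /halfplane/= in_itv/= andbT.
by apply: open_comp; [move=> z _; exact: cvg_snd|exact: interval_open].
Qed.

Lemma halfplane_bounded (f : R -> R -> R) (M a : R) : 0 <= M -> 0 < a -> a <= M ->
  continuous2_on halfplane f ->
  exists B, forall p s, `|p| <= M -> a <= s <= M -> `|f p s| <= B.
Proof.
move=> M0 a0 aM cf.
pose D : set (R * R) := `[- M, M]%classic `*` `[a, M]%classic.
have D0 : D !=set0 by exists (0, a); split; rewrite /= in_itv/= ?oppr_le0 ?M0 ?lexx ?aM.
have cD : compact D by apply: compact_setX; exact: segment_compact.
have DH : D `<=` halfplane.
  by move=> [p s] [_ /=]; rewrite /halfplane/= in_itv/= => /andP[/(lt_le_trans a0)].
have cfD : {within D, continuous (fun z => `|f z.1 z.2|)}.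
  apply: (continuous_subspaceW DH) => z.
  apply: continuous_comp; last exact: norm_continuous.
  exact: ((Ck0P f halfplane_open).2 cf).1.
have [c _ fc] := compact_EVT_max D0 cD cfD.
exists `|f c.1 c.2| => p s pM sM; apply: (fc (p, s)); apply/mem_set.
by split; rewrite /= in_itv//= -ler_norml.
Qed.

End Rectangle.

(** * The mean field game system *)

Section MeanFieldGame.
Context {R : realType}.
Variables (C0 gamma : R) (Cbar : R -> R) (T : R) (H : R -> R -> R) (m0 : R -> R).
Variables (u m : R -> R -> R).
Hypotheses (T0 : 0 < T) (ham : hamiltonian C0 gamma Cbar H).
Hypothesis sol : classical_solution T H m0 u m.

(** The continuity equation reads [m_t = (m * drift)_x]. *)
Definition drift (x t : R) : R := d1 H (d1 u x t) (m x t).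
Definition drift_x (x t : R) : R :=
  d1 (d1 H) (d1 u x t) (m x t) * d1 (d1 u) x t
  + d2 (d1 H) (d1 u x t) (m x t) * d1 m x t.
Definition drift_t (x t : R) : R :=
  d1 (d1 H) (d1 u x t) (m x t) * d2 (d1 u) x t
  + d2 (d1 H) (d1 u x t) (m x t) * d2 m x t.

Let so := @strip_open R T.
Let ho := @halfplane_open R.

Lemma solution_u_C2 : Ck 2 (strip T) u.
Proof. exact: Ck_extends_Ck so (u_C2 sol).2. Qed.

Lemma solution_m_C1 : Ck 1 (strip T) m.
Proof. exact: Ck_extends_Ck so (m_C1 sol).2. Qed.

Let m_pos (x t : R) : strip T (x, t) -> halfplane (d1 u x t, m x t).
Proof.
by move=> /andP[t0 tT]; apply: (m_gt0 sol); rewrite !ltW.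
Qed.

Let is_derive_Hcomp1 (f : R -> R -> R) (x t : R) : Ck 1 halfplane f -> 0 < t < T ->
  is_derive x 1 (fun y => f (d1 u y t) (m y t))
   (d1 f (d1 u x t) (m x t) * d1 (d1 u) x t + d2 f (d1 u x t) (m x t) * d1 m x t).
Proof.
move=> fC tT; apply: (is_derive_comp2 ho fC (a := fun y => d1 u y t)
  (b := fun y => m y t)).
- exact: m_pos.
- exact: Ck_is_derive1 (Ck_d1 solution_u_C2) tT.
- exact: Ck_is_derive1 solution_m_C1 tT.
Qed.

Let is_derive_Hcomp2 (f : R -> R -> R) (x t : R) : Ck 1 halfplane f -> 0 < t < T ->
  is_derive t 1 (fun s => f (d1 u x s) (m x s))
   (d1 f (d1 u x t) (m x t) * d2 (d1 u) x t + d2 f (d1 u x t) (m x t) * d2 m x t).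
Proof.
move=> fC tT; apply: (is_derive_comp2 ho fC (a := d1 u x) (b := m x)).
- exact: m_pos.
- exact: Ck_is_derive2 (Ck_d1 solution_u_C2) tT.
- exact: Ck_is_derive2 solution_m_C1 tT.
Qed.

Let HC1 : Ck 1 halfplane H.
Proof. exact: Ck_weaken (H_C4 ham). Qed.

Let HpC1 : Ck 1 halfplane (d1 H).
Proof. exact: Ck_weaken (Hp_C4 ham). Qed.

Lemma drift_xE (x t : R) : 0 < t < T -> d1 drift x t = drift_x x t.
Proof. by move=> tT; exact: (is_derive_derive1 (is_derive_Hcomp1 x HpC1 tT)). Qed.

Lemma drift_tE (x t : R) : 0 < t < T -> d2 drift x t = drift_t x t.
Proof. by move=> tT; exact: (is_derive_derive1 (is_derive_Hcomp2 x HpC1 tT)). Qed.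

(** Differentiating the Hamilton-Jacobi equation in [x] eliminates the mixed
    derivative of [u] from [drift_t]. *)
Lemma u_tx (x t : R) : 0 < t < T -> d2 (d1 u) x t =
  d1 H (d1 u x t) (m x t) * d1 (d1 u) x t + d2 H (d1 u x t) (m x t) * d1 m x t.
Proof.
move=> tT; rewrite -(schwarz so solution_u_C2)//.
have utE : (fun y => d2 u y t) = (fun y => H (d1 u y t) (m y t)).
  apply/funext => y; apply/esym/eqP; rewrite -subr_eq0 addrC.
  exact/eqP/(hamilton_jacobi sol).
by rewrite {1}/d1 utE; exact: (is_derive_derive1 (is_derive_Hcomp1 x HC1 tT)).
Qed.

Lemma m_evolution (x t : R) : 0 < t < T ->
  d2 m x t = d1 m x t * drift x t + m x t * d1 drift x t.
Proof.
move=> tT; have /eqP := continuity_equation sol x tT.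
rewrite subr_eq0 => /eqP ->; apply: is_derive_derive1.
apply: is_derive1M; first exact: Ck_is_derive1 solution_m_C1 tT.
by rewrite drift_xE// /drift_x; exact: is_derive_Hcomp1.
Qed.

Lemma Hpm_Hmp (p s : R) : 0 < s -> d1 (d2 H) p s = d2 (d1 H) p s.
Proof.
by move=> s0; apply: (schwarz ho); [exact: Ck_weaken (H_C4 ham)|].
Qed.

Let comp_cont (f : R -> R -> R) : Ck 0 halfplane f ->
  continuous2_on (strip T) (fun x t => f (d1 u x t) (m x t)).
Proof.
move=> /(Ck0P _ ho) cf; apply: (continuous2_on_comp cf m_pos).
  exact: (Ck0P _ so).1 (Ck_pred (Ck_d1 solution_u_C2)).
exact: (Ck0P _ so).1 (Ck_pred solution_m_C1).
Qed.

Let cHp := comp_cont (Ck_weaken (leq0n 4) (Hp_C4 ham)).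
Let cHpp := comp_cont (Ck_weaken (leq0n 4) (Hpp_C4 ham)).
Let cHpm := comp_cont (Ck_weaken (leq0n 3) (Ck_d2 (Hp_C4 ham))).

Let cuxx : continuous2_on (strip T) (d1 (d1 u)).
Proof. exact: (Ck0P _ so).1 (Ck_d1 (Ck_d1 solution_u_C2)). Qed.
Let cuxt : continuous2_on (strip T) (d2 (d1 u)).
Proof. exact: (Ck0P _ so).1 (Ck_d2 (Ck_d1 solution_u_C2)). Qed.
Let cmx : continuous2_on (strip T) (d1 m).
Proof. exact: (Ck0P _ so).1 (Ck_d1 solution_m_C1). Qed.
Let cmt : continuous2_on (strip T) (d2 m).
Proof. exact: (Ck0P _ so).1 (Ck_d2 solution_m_C1). Qed.

Lemma along_solution_continuous (f : R -> R -> R) (t : R) : Ck 0 halfplane f ->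
  0 < t < T -> continuous (fun x => f (d1 u x t) (m x t)).
Proof. by move=> /comp_cont/(Ck0P _ so); exact: strip_continuous1. Qed.

Lemma drift_C1 : Ck 1 (strip T) drift.
Proof.
apply: (@Ck1_intro R (strip T) drift drift_x drift_t so).
- by move=> x t tT; rewrite /drift_x; exact: is_derive_Hcomp1.
- by move=> x t tT; rewrite /drift_t; exact: is_derive_Hcomp2.
- exact: cHp.
- by apply: continuous2_onD; exact: continuous2_onM.
- by apply: continuous2_onD; exact: continuous2_onM.
Qed.

Let pu : strip_periodic T u.
Proof. by move=> t /andP[t0 tT]; apply: (u_periodic sol); rewrite !ltW. Qed.
Let pm : strip_periodic T m.
Proof. by move=> t /andP[t0 tT]; apply: (m_periodic sol); rewrite !ltW. Qed.

(** [H] is controlled on compact subsets of the half-plane only, which is why a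
    positive lower bound on [m] enters. *)
Lemma mfg_bounded_C1 : exists M, bounded_C1 T m M /\ bounded_C1 T drift M.
Proof.
have [_ [_ eux eut]] := (u_C2 sol).2.
have [eux0 [_ euxx euxt]] := eux.
have [em [_ emx emt]] := (m_C1 sol).2.
have pux := strip_periodic_d1 pu.
have [B1 b1] := strip_periodic_bounded T0 pux (conj eux0 I).
have [B2 b2] := strip_periodic_bounded T0 (strip_periodic_d1 pux) euxx.
have [B3 b3] := strip_periodic_bounded T0 (strip_periodic_d2 pux) euxt.
have [B4 b4] := strip_periodic_bounded T0 pm (conj em I).
have [B5 b5] := strip_periodic_bounded T0 (strip_periodic_d1 pm) emx.
have [B6 b6] := strip_periodic_bounded T0 (strip_periodic_d2 pm) emt.
have [a a0 am] := strip_periodic_lower_bound T0 (m_periodic sol) (m_C1 sol).1 (m_gt0 sol).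
pose L := a + `|B1| + `|B4|.
have L0 : 0 <= L by rewrite /L !addr_ge0// ltW.
have aL : a <= L by rewrite /L -addrA lerDl addr_ge0.
have rect x t : 0 < t < T -> `|d1 u x t| <= L /\ a <= m x t <= L.
  move=> tT; have := b1 x t tT; have := b4 x t tT; have := am x t tT.
  have := ler_norm B1; have := ler_norm B4; have := ler_norm (m x t).
  have := normr_ge0 B1; have := normr_ge0 B4.
  rewrite /L; move: (`|d1 u x t|) (`|m x t|) (m x t) => A B D *.
  by split; [lra|apply/andP; split; lra].
have bnd (f : R -> R -> R) : Ck 0 halfplane f ->
    exists B, forall x t, 0 < t < T -> `|f (d1 u x t) (m x t)| <= B.
  move=> /(Ck0P _ ho) cf; have [B Bf] := halfplane_bounded L0 a0 aL cf.
  by exists B => x t tT; have [? ?] := rect x t tT; exact: Bf.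
have [E1 e1] := bnd _ (Ck_weaken (leq0n 4) (Hp_C4 ham)).
have [E2 e2] := bnd _ (Ck_weaken (leq0n 4) (Hpp_C4 ham)).
have [E3 e3] := bnd _ (Ck_weaken (leq0n 3) (Ck_d2 (Hp_C4 ham))).
pose M := Num.max B4 (Num.max B5 (Num.max B6 (Num.max E1
  (Num.max (E2 * B2 + E3 * B5) (E2 * B3 + E3 * B6))))).
have M4 : B4 <= M by rewrite /M !le_max lexx ?orbT.
have M5 : B5 <= M by rewrite /M !le_max lexx ?orbT.
have M6 : B6 <= M by rewrite /M !le_max lexx ?orbT.
have M1 : E1 <= M by rewrite /M !le_max lexx ?orbT.
have M7 : E2 * B2 + E3 * B5 <= M by rewrite /M !le_max lexx ?orbT.
have M8 : E2 * B3 + E3 * B6 <= M by rewrite /M !le_max lexx ?orbT.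
exists M; split; split.
- exact: solution_m_C1.
- exact: pm.
- by move=> x t tT; exact: le_trans (b4 x t tT) M4.
- by move=> x t tT; exact: le_trans (b5 x t tT) M5.
- by move=> x t tT; exact: le_trans (b6 x t tT) M6.
- exact: drift_C1.
- by move=> t tT x; rewrite /drift (pux _ tT) (pm tT).
- by move=> x t tT; exact: le_trans (e1 x t tT) M1.
- move=> x t tT; rewrite drift_xE// (le_trans _ M7)//.
  rewrite (le_trans (ler_normD _ _))// !normrM.
  by apply: lerD; apply: ler_pM => //; [exact: e2|exact: b2|exact: e3|exact: b5].
- move=> x t tT; rewrite drift_tE// (le_trans _ M8)//.
  rewrite (le_trans (ler_normD _ _))// !normrM.
  by apply: lerD; apply: ler_pM => //; [exact: e2|exact: b3|exact: e3|exact: b6].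
Qed.

End MeanFieldGame.

(** * Pointwise algebra and conclusion *)

Section Algebra.
Context {R : realType}.

Lemma rate_identity (m mx mt w wx wt uxx Hm Hpp Hpm : R) :
  wx = Hpp * uxx + Hpm * mx -> mt = mx * w + m * wx ->
  wt = Hpp * (w * uxx + Hm * mx) + Hpm * mt ->
  m * (mt * wx - mx * wt) = (mt - mx * (w + m / 2 * Hpm)) ^+ 2
    - mx ^+ 2 * (m ^+ 2 / 4 * Hpm ^+ 2 + m * Hpp * Hm).
Proof. by move=> -> -> ->; field. Qed.

(** With [A = - m Hm Hpp mx^2], [B = m Hpm mx] and [D = m Hpp uxx] the left side
    of [rate_identity] is [D^2 + B D + A] and ellipticity says
    [(C0 + 1) B^2 <= 4 C0 A].  Subtracting [(A + D^2) / (2 (1 + C0))] leaves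
    [q D^2 + B D + q A] with [q^2 >= C0 / (C0 + 1)], which is nonnegative by
    completing the square. *)
Lemma rate_lower_bound (C0 m mx mt w wx wt uxx Hm Hpp Hpm : R) : 0 < C0 ->
  (1 + C0^-1) * m ^+ 2 * Hpm ^+ 2 <= - 4 * m * Hm * Hpp ->
  wx = Hpp * uxx + Hpm * mx -> mt = mx * w + m * wx ->
  wt = Hpp * (w * uxx + Hm * mx) + Hpm * mt ->
  (2 * (1 + C0))^-1 * (- m * Hm * Hpp * mx ^+ 2 + m ^+ 2 * Hpp ^+ 2 * uxx ^+ 2)
    <= m * (mt * wx - mx * wt).
Proof.
move=> C0_gt0 ell wxE mtE wtE.
pose A := - m * Hm * Hpp * mx ^+ 2; pose B := m * Hpm * mx; pose D := m * Hpp * uxx.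
have -> : m * (mt * wx - mx * wt) = D ^+ 2 + B * D + A.
  by rewrite wtE mtE wxE /A /B /D; ring.
have -> : - m * Hm * Hpp * mx ^+ 2 + m ^+ 2 * Hpp ^+ 2 * uxx ^+ 2 = A + D ^+ 2.
  by rewrite /A /D; ring.
have BA : (C0 + 1) * B ^+ 2 <= 4 * C0 * A.
  have : C0 * mx ^+ 2 * ((1 + C0^-1) * m ^+ 2 * Hpm ^+ 2) <=
      C0 * mx ^+ 2 * (- 4 * m * Hm * Hpp).
    by apply: ler_wpM2l => //; rewrite mulr_ge0 ?sqr_ge0// ltW.
  have -> : C0 * mx ^+ 2 * ((1 + C0^-1) * m ^+ 2 * Hpm ^+ 2) = (C0 + 1) * B ^+ 2.
    by rewrite /B; field; rewrite gt_eqF.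
  by have -> : C0 * mx ^+ 2 * (- 4 * m * Hm * Hpp) = 4 * C0 * A by rewrite /A; ring.
move: A B D BA => A B D BA {ell wxE mtE wtE}.
have A0 : 0 <= A.
  have : 0 <= 4 * C0 * A by rewrite (le_trans _ BA)// mulr_ge0 ?sqr_ge0//; lra.
  by rewrite pmulr_rge0// mulr_gt0.
have C1_gt0 : 0 < 2 * (1 + C0) by lra.
rewrite mulrC ler_pdivrMr// -subr_ge0.
have q0 : 0 < 4 * (2 * C0 + 1) by lra.
rewrite -(pmulr_rge0 _ q0).
have -> : 4 * (2 * C0 + 1) * ((D ^+ 2 + B * D + A) * (2 * (1 + C0)) - (A + D ^+ 2))
  = (2 * (2 * C0 + 1) * D + 2 * (C0 + 1) * B) ^+ 2
    + 4 * ((C0 + 1) * (4 * C0 * A - (C0 + 1) * B ^+ 2) + A) by ring.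
by rewrite addr_ge0 ?sqr_ge0// mulr_ge0// addr_ge0// mulr_ge0 ?subr_ge0//; lra.
Qed.

Lemma elliptic_density_stationary (m mx mt w wx uxx Hm Hpp Hpm : R) :
  wx = Hpp * uxx + Hpm * mx -> mt = mx * w + m * wx -> mx = 0 -> mt = 0 ->
  - m * Hm * Hpp * mx ^+ 2 + m ^+ 2 * Hpp ^+ 2 * uxx ^+ 2 = 0.
Proof.
move=> -> + mx0; rewrite {}mx0 mul0r mulr0 add0r addr0 => -> mt0.
by rewrite expr0n mulr0 add0r -!exprMn -mulrA mt0 expr0n.
Qed.

End Algebra.

Theorem proposition3p1 (R : realType) (C0 : R) (C0_gt0 : 0 < C0) :
  exists2 C : R, 0 < C &
  forall (gamma alpha : R) (Cbar : R -> R) (T : R)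
    (H : R -> R -> R) (m0 : R -> R) (u m : R -> R -> R) (h h'' : R -> R),
  1 < gamma -> 0 < alpha < 1 ->
  {within `]0, +oo[, continuous Cbar} -> (forall s, 0 < s -> 0 < Cbar s) ->
  0 < T ->
  initial_density alpha m0 ->
  hamiltonian C0 gamma Cbar H ->
  ellipticity C0 H ->
  classical_solution T H m0 u m ->
  W2oo h h'' ->
  let F t := \int[T]_ x (h (m x t)) in
  let ux := d1 u in
  let uxx := d1 (d1 u) in
  let mx := d1 m in
  let mt := d2 m in
  let Hp x t := d1 H (ux x t) (m x t) in
  let Hm x t := d2 H (ux x t) (m x t) in
  let Hpp x t := d1 (d1 H) (ux x t) (m x t) in
  let Hpm x t := d2 (d1 H) (ux x t) (m x t) in
  [/\ forall t, 0 < t < T -> derivable F t 1,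
      [lipschitz F^`() t | t in `]0, T[],
      {ae @lebesgue_measure R, forall t, 0 < t < T ->
        derivable F^`() t 1 /\
        F^`()^`() t =
          \int[T]_ x (h'' (m x t) *
             (mt x t - mx x t * (Hp x t + m x t / 2 * Hpm x t)) ^+ 2)
          - \int[T]_ x (h'' (m x t) * mx x t ^+ 2 *
             (m x t ^+ 2 / 4 * Hpm x t ^+ 2 + m x t * Hpp x t * Hm x t))} &
      {ae @lebesgue_measure R, forall s,
         (exists x t, 0 <= t <= T /\ s = m x t) -> 0 < h'' s} ->
      {ae @lebesgue_measure R, forall t, 0 < t < T ->
        F^`()^`() t >=
          C^-1 * \int[T]_ x (h'' (m x t) *
             (- m x t * Hm x t * Hpp x t * mx x t ^+ 2
              + m x t ^+ 2 * Hpp x t ^+ 2 * uxx x t ^+ 2))}].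
Proof.
exists (2 * (1 + C0)); first by rewrite mulr_gt0// addr_gt0.
move=> gamma alpha Cbar T H m0 u m h h2 _ _ _ _ T0 _ ham ell sol hW.
move=> F ux uxx mx mt Hp Hm Hpp Hpm.
have [K [mh2 hL dh h'L dh']] := W2oo_representative hW.
have [M [mM wM]] := mfg_bounded_C1 T0 ham sol.
pose w := drift H u m.
have evol x t : 0 < t < T -> mt x t = mx x t * w x t + m x t * d1 w x t.
  by move=> tT; exact: (m_evolution ham sol).
have wxE x t : 0 < t < T -> d1 w x t = Hpp x t * uxx x t + Hpm x t * mx x t.
  by move=> tT; exact: (drift_xE ham sol).
have wtE x t : 0 < t < T ->
    d2 w x t = Hpp x t * (w x t * uxx x t + Hm x t * mx x t) + Hpm x t * mt x t.
  by move=> tT; rewrite /w (drift_tE ham sol)// /drift_t (u_tx ham sol).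
have dF t : 0 < t < T -> is_derive t 1 F (energy_rate m w h t).
  exact: (is_derive_energy mM wM evol hL dh h'L).
have F'E t : 0 < t < T -> F^`()%classic t = energy_rate m w h t.
  by move=> tT; exact: is_derive_derive1 (dF t tT).
have dF' t : 0 < t < T -> regular m h h2 t ->
    is_derive t 1 F^`()%classic (\int[lebesgue_measure]_(x in `[0, 1])
      (m x t * h2 (m x t) * (mt x t * d1 w x t - mx x t * d2 w x t))).
  move=> tT reg; have := is_derive_energy_rate mM wM mh2 hL dh h'L dh' tT reg.
  apply: near_eq_is_derive; have [r r0 Hr] := strip_near tT.
  by exists r => // s /=; rewrite distrC => /Hr sT; rewrite F'E.
(* the factor [h2 (m x t)] is only meaningful at regular times *)
have areg : {ae lebesgue_measure, forall t, 0 < t < T -> regular m h h2 t}.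
  exact: ae_regular mM dh'.
have mcont t : 0 < t < T -> continuous (fun x => m x t).
  exact: strip_continuous1 (solution_m_C1 sol).
have mxcont t : 0 < t < T -> continuous (fun x => mx x t).
  exact: strip_continuous1 (Ck_d1 (solution_m_C1 sol)).
have mtcont t : 0 < t < T -> continuous (fun x => mt x t).
  exact: strip_continuous1 (Ck_d2 (solution_m_C1 sol)).
have uxxcont t : 0 < t < T -> continuous (fun x => uxx x t).
  exact: strip_continuous1 (Ck_d1 (Ck_d1 (solution_u_C2 sol))).
have Hpcont t : 0 < t < T -> continuous (fun x => Hp x t).
  exact: (along_solution_continuous sol (Ck_weaken (leq0n 4) (Hp_C4 ham))).
have Hppcont t : 0 < t < T -> continuous (fun x => Hpp x t).
  exact: (along_solution_continuous sol (Ck_weaken (leq0n 4) (Hpp_C4 ham))).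
have Hmcont t : 0 < t < T -> continuous (fun x => Hm x t).
  exact: (along_solution_continuous sol (Ck_weaken (leq0n 3) (Ck_d2 (H_C4 ham)))).
have Hpmcont t : 0 < t < T -> continuous (fun x => Hpm x t).
  exact: (along_solution_continuous sol (Ck_weaken (leq0n 3) (Ck_d2 (Hp_C4 ham)))).
pose X x t := mt x t - mx x t * (Hp x t + m x t / 2 * Hpm x t).
pose Y x t := mx x t ^+ 2 * (m x t ^+ 2 / 4 * Hpm x t ^+ 2 + m x t * Hpp x t * Hm x t).
pose Z x t := - m x t * Hm x t * Hpp x t * mx x t ^+ 2
  + m x t ^+ 2 * Hpp x t ^+ 2 * uxx x t ^+ 2.
have Xcont t : 0 < t < T -> continuous (fun x => X x t ^+ 2).
  move=> tT; apply: continuous_sqrf; apply: continuous_addf; first exact: mtcont.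
  apply: continuous_oppf; apply: continuous_mulf; first exact: mxcont.
  apply: continuous_addf; first exact: Hpcont.
  apply: continuous_mulf; last exact: Hpmcont.
  by apply: continuous_mulf; [exact: mcont|exact: cst_continuous].
have Ycont t : 0 < t < T -> continuous (fun x => Y x t).
  move=> tT; apply: continuous_mulf; first by apply: continuous_sqrf; exact: mxcont.
  apply: continuous_addf.
    apply: continuous_mulf; last by apply: continuous_sqrf; exact: Hpmcont.
    by apply: continuous_mulf; [apply: continuous_sqrf; exact: mcont|exact: cst_continuous].
  apply: continuous_mulf; last exact: Hmcont.
  by apply: continuous_mulf; [exact: mcont|exact: Hppcont].
have Zcont t : 0 < t < T -> continuous (fun x => Z x t).
  move=> tT; apply: continuous_addf.
    apply: continuous_mulf; last by apply: continuous_sqrf; exact: mxcont.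
    apply: continuous_mulf; last exact: Hppcont.
    by apply: continuous_mulf; [apply: continuous_oppf; exact: mcont|exact: Hmcont].
  apply: continuous_mulf; last by apply: continuous_sqrf; exact: uxxcont.
  by apply: continuous_mulf; apply: continuous_sqrf; [exact: mcont|exact: Hppcont].
have int t (c : R -> R) : 0 < t < T -> regular m h h2 t -> continuous c ->
    (forall x, mx x t = 0 -> mt x t = 0 -> c x = 0) ->
    lebesgue_measure.-integrable `[0, 1] (EFin \o (fun x => h2 (m x t) * c x)).
  exact: (regular_integrable mM mh2 hL dh h'L).
have X0 t x : mx x t = 0 -> mt x t = 0 -> X x t ^+ 2 = 0.
  by rewrite /X => -> ->; rewrite mul0r subr0 expr0n.
have Y0 t x : mx x t = 0 -> mt x t = 0 -> Y x t = 0.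
  by rewrite /Y => -> _; rewrite expr0n mul0r.
have Z0 t x : 0 < t < T -> mx x t = 0 -> mt x t = 0 -> Z x t = 0.
  by move=> tT; apply: elliptic_density_stationary (wxE x t tT) (evol x t tT).
have idXY x t : 0 < t < T ->
    m x t * (mt x t * d1 w x t - mx x t * d2 w x t) = X x t ^+ 2 - Y x t.
  by move=> tT; apply: rate_identity; [exact: wxE|exact: evol|exact: wtE].
have F''E t : 0 < t < T -> regular m h h2 t -> is_derive t 1 F^`()%classic
   (\int[lebesgue_measure]_(x in `[0, 1]) (h2 (m x t) * (X x t ^+ 2 - Y x t))).
  move=> tT reg; have := dF' t tT reg.
  suff -> : \int[lebesgue_measure]_(x in `[0, 1])
      (m x t * h2 (m x t) * (mt x t * d1 w x t - mx x t * d2 w x t)) =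
    \int[lebesgue_measure]_(x in `[0, 1]) (h2 (m x t) * (X x t ^+ 2 - Y x t)) by [].
  by apply: eq_Rintegral => x _; rewrite (mulrC (m x t)) -mulrA idXY.
split.
- by move=> t tT; have [] := dF t tT.
- have [C HC] := energy_rate_lipschitz mM wM mh2 hL dh h'L dh'.
  exists C; split; first exact: num_real.
  move=> C' CC' [s t] [/= ]; rewrite !in_itv/= => sT tT.
  by rewrite !F'E// (le_trans (HC _ _ sT tT))// ler_wpM2r// ltW.
- move: areg; apply: ae_imply => t reg tT; have {}reg := reg tT.
  have dd := F''E t tT reg; split; first by case: dd.
  rewrite (is_derive_derive1 dd).
  transitivity (\int[lebesgue_measure]_(x in `[0, 1])
      (h2 (m x t) * X x t ^+ 2 - h2 (m x t) * Y x t)).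
    by apply: eq_Rintegral => x _; rewrite mulrBr.
  rewrite RintegralB//; last 2 first.
  + by apply: int => //; [exact: Xcont|move=> x; exact: X0].
  + by apply: int => //; [exact: Ycont|move=> x; exact: Y0].
  by congr (_ - _); apply: eq_Rintegral => x _; rewrite /Y mulrA.
(* positivity of [h2] is lost on a null set of values of [m], again reached only
   at stationary points *)
move=> h2pos.
have := ae_strip_regular h2pos (solution_m_C1 sol).
move=> /(ae_and areg); apply: ae_imply => t [reg pos] tT.
have {}reg := reg tT; have {}pos := pos tT.
rewrite (is_derive_derive1 (F''E t tT reg)).
have iZ : lebesgue_measure.-integrable `[0, 1] (EFin \o (fun x => h2 (m x t) * Z x t)).
  by apply: int => //; [exact: Zcont|move=> x; exact: Z0].
rewrite -RintegralZl//.
have cq x : (2 * (1 + C0))^-1 * (h2 (m x t) * Z x t) =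
    h2 (m x t) * ((2 * (1 + C0))^-1 * Z x t) by rewrite mulrCA.
apply: ae_le_Rintegral.
- exact: measurable_itv.
- rewrite (_ : (fun x => _) = (fun x => h2 (m x t) * ((2 * (1 + C0))^-1 * Z x t))).
    apply: int => //; first by apply: continuous_mulf; [exact: cst_continuous|exact: Zcont].
    by move=> x mx0 mt0; rewrite Z0// mulr0.
  by apply/funext => x; rewrite cq.
- apply: int => //; first apply: continuous_addf.
  + exact: Xcont.
  + by apply: continuous_oppf; exact: Ycont.
  by move=> x mx0 mt0; rewrite X0// Y0// subrr.
move: pos; apply: ae_imply => x pos _.
rewrite cq; have [/pos h2x|] := boolP ((d1 m x t != 0) || (d2 m x t != 0)).
  have {}h2x : 0 < h2 (m x t).
    apply: contrapT => nh2; apply: h2x => /(_ _) H1; apply: nh2; apply: H1.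
    by exists x, t; split => //; case/andP: tT => ? ?; rewrite !ltW.
  rewrite ler_wpM2l ?(ltW h2x)//.
  rewrite -idXY//; apply: (rate_lower_bound C0_gt0 _ (wxE _ _ tT) (evol _ _ tT)
    (wtE _ _ tT)).
  have m_gt : 0 < m x t by apply: (m_gt0 sol); case/andP: tT => ? ?; rewrite !ltW.
  by have := ell (ux x t) _ m_gt; rewrite (Hpm_Hmp ham).
rewrite negb_or !negbK => /andP[/eqP mx0 /eqP mt0].
by rewrite Z0// X0// Y0// subrr !mulr0.
Qed.
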